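(* Let $g_1:\mathbb{R}^d\to[0,\infty)$ be differentiable almost everywhere, let $U$ be a $d\times d$ orthogonal matrix, and define $g_2(\bm z)=g_1(U\bm z)$. Assume that for each of $g_1,g_2$ the optimal drift equation $\nabla g(\bm z)/g(\bm z)=\bm z$ has a unique solution and that the Laplace importance sampling integrands $g_1^{\mathrm I},g_2^{\mathrm I}$ are well defined. Then there is an orthogonal matrix $V$ with $g_2^{\mathrm I}(\bm z)=g_1^{\mathrm I}(V\bm z)$ for all $\bm z$; consequently $g_1$ and $g_2$ have the same IS-active subspaces, and their analytic expressions in the $d$-dimensional IS-active subspace coincide: $g_1^{\mathrm{IA}}(\bm z)=g_2^{\mathrm{IA}}(\bm z)$.
   Context: Laplace importance sampling: for a nonnegative $g$, let $F(\bm z)=\ln g(\bm z)$, let $\bm\mu^*$ be the (assumed unique) solution of $\nabla g(\bm z)/g(\bm z)=\bm z$, let $\Gamma^*=\big(I_d-\nabla^2F(\bm\mu^* )\big)^{-1}$ (assumed to exist and be positive definite, with $F$ twice differentiable at $\bm\mu^*$), and let $L^*$ satisfy $L^*{L^*}^T=\Gamma^*$ (e.g. the Cholesky factor). The IS integrand is $g^{\mathrm I}(\bm z)=g(L^*\bm z+\bm\mu^* )\sqrt{\det\Gamma^*}\exp\!\big(\tfrac12\bm z^T\bm z-\tfrac12(L^*\bm z+\bm\mu^* )^T(L^*\bm z+\bm\mu^* )\big)$, so that $\mathbb{E}g(\bm Z)=\mathbb{E}g^{\mathrm I}(\bm Z)$ for $\bm Z\sim N(\bm 0,I_d)$. For an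 a.e. differentiable $h$, the gradient information matrix is $C=\mathbb{E}\big(\nabla h(\bm Z)\nabla h(\bm Z)^T\big)=Q\Lambda Q^T$ (eigendecomposition, $Q$ orthogonal, eigenvalues descending); the $r$-dimensional active subspace of $h$ is spanned by the first $r$ columns of $Q$. The IS-active subspaces of $g$ are the active subspaces of $g^{\mathrm I}$, and $g^{\mathrm{IA}}(\bm z):=g^{\mathrm I}(Q\bm z)$ with $Q$ the eigenvector matrix of the gradient information matrix of $g^{\mathrm I}$. Two functions related by $h_2(\bm z)=h_1(V\bm z)$, $V$ orthogonal, are said to have the same active subspaces when, identifying their coordinates as coordinates of the same vector in orthonormal bases related by $V$, the $r$-dimensional active subspaces coincide for every $r$, with eigenvector matrices chosen correspondingly ($Q_2=V^TQ_1$) in case of repeated eigenvalues. It is assumed the relevant gradient information matrices are finite. *)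

(* Defs.v *)
From HB Require Import structures.
From mathcomp Require Import all_boot all_order all_algebra.
From mathcomp Require Import all_classical all_reals all_analysis.

Set Implicit Arguments.
Unset Strict Implicit.
Unset Printing Implicit Defensive.

Import Order.TTheory GRing.Theory Num.Theory.
Import numFieldNormedType.Exports.

Local Open Scope classical_set_scope.
Local Open Scope ring_scope.

Section LaplaceIS.
Variables (R : realType) (d : nat).
Implicit Types (g h F : 'cV[R]_d -> R) (z mu : 'cV[R]_d) (M Q U V Gam L : 'M[R]_d).

Definition e_ (i : 'I_d) : 'cV[R]_d := delta_mx i 0.

Definition grad h z : 'cV[R]_d := \col_i ('D_(e_ i) h z).

Definition hessian F z : 'M[R]_d :=
  \matrix_(i, j) ('D_(e_ j) (fun w => 'D_(e_ i) F w) z).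

Definition twice_differentiable_at F mu : Prop :=
  (\forall w \near mu, differentiable F w) /\ differentiable (grad F) mu.

Definition orthogonal_mx M : Prop := M^T *m M = 1%:M.

Definition posdef_mx M : Prop :=
  M^T = M /\ forall v : 'cV[R]_d, v != 0 -> 0 < (v^T *m M *m v) 0 0.

Definition drift_solution g z : Prop :=
  [/\ 0 < g z, differentiable g z & (g z)^-1 *: grad g z = z].

Definition laplace_IS_params g mu Gam L : Prop :=
  drift_solution g mu /\
  (forall z, drift_solution g z -> z = mu) /\
  twice_differentiable_at (fun w => ln (g w)) mu /\
  (1%:M - hessian (fun w => ln (g w)) mu) \in unitmx /\
  Gam = invmx (1%:M - hessian (fun w => ln (g w)) mu) /\
  posdef_mx Gam /\
  L *m L^T = Gam.

Definition gI g mu Gam L z : R :=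
  let w := L *m z + mu in
  g w * Num.sqrt (\det Gam) *
  expR ((z^T *m z) 0 0 / 2 - (w^T *m w) 0 0 / 2).

Definition rotfun g U : 'cV[R]_d -> R := fun z => g (U *m z).

End LaplaceIS.

(** Expectation under the standard Gaussian N(0, I_d), written as the
    iterated (Fubini) integral of the product density against the
    (completed) Lebesgue measure on R, extended-real valued. *)
Section Gauss.
Variable R : realType.
Local Open Scope ereal_scope.

Definition std_normal_pdf (t : R) : R :=
  ((Num.sqrt (pi *+ 2))^-1 * expR (- (t ^+ 2) / 2))%R.

Fixpoint gauss_iter (n : nat) (F : (nat -> R) -> \bar R) : (nat -> R) -> \bar R :=
  match n with
  | 0 => F
  | k.+1 => fun x =>
      \int[@completed_lebesgue_measure R]_t
        ((std_normal_pdf t)%:E * gauss_iter k F (fun i => if i == k then t else x i))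
  end.

Definition gauss_exp (d : nat) (f : 'cV[R]_d -> R) : \bar R :=
  gauss_iter d (fun x => (f (\col_(i < d) x (nat_of_ord i)))%:E) (fun _ => 0%R).

Definition gauss_integrable (d : nat) (f : 'cV[R]_d -> R) : Prop :=
  gauss_exp (fun z => `|f z|%R) < +oo.

(** g is differentiable almost everywhere: the set of points where g is not
    differentiable is null (for the Gaussian, equivalently Lebesgue, measure) *)
Definition ae_differentiable (d : nat) (g : 'cV[R]_d -> R) : Prop :=
  gauss_exp (fun z => if `[< differentiable g z >] then 0%R else 1%R) = 0.

Definition grad_info (d : nat) (h : 'cV[R]_d -> R) : 'M[R]_d :=
  \matrix_(i, j) fine (gauss_exp (fun z => (grad h z i 0 * grad h z j 0)%R)).

Definition finite_grad_info (d : nat) (h : 'cV[R]_d -> R) : Prop :=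
  forall i : 'I_d, gauss_integrable (fun z => (grad h z i 0 ^+ 2)%R).

Definition eigvec_mx (d : nat) (C Q : 'M[R]_d) : Prop :=
  orthogonal_mx Q /\
  exists lam : 'rV[R]_d,
    (forall i j : 'I_d, (i <= j)%N -> (lam 0 j <= lam 0 i)%R) /\
    C = Q *m diag_mx lam *m Q^T.

End Gauss.

(* Main.v *)
Require Import Defs.
From HB Require Import structures.
From mathcomp Require Import all_boot all_order all_algebra.
From mathcomp Require Import all_classical all_reals all_analysis.
From mathcomp Require Import measurable_realfun.
From mathcomp Require Import lebesgue_integral_nonneg lebesgue_integrable.
From mathcomp Require Import lebesgue_integral_monotone_convergence.
From mathcomp Require Import lebesgue_integral_fubini.
From mathcomp Require Import fingroup perm ring lra zify.

(** With [V = L1^-1 U L2], uniqueness of the drift gives [U mu2 = mu1] and the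
    chain rule gives [Gam2 = U^T Gam1 U], so that [L1 (V V^T) L1^T = Gam1]: [V] is
    orthogonal and [g2^I = g1^I o V].  It remains to see that
    [C2 = V^T C1 V] for the gradient information matrices, which is the
    rotation invariance of the Gaussian expectation.

    Expectations being iterated integrals against completed Lebesgue measure,
    that invariance comes from the change of variables for invertible matrices,
    obtained by an LUP decomposition: replacing one coordinate at a time is a
    one-dimensional affine change of variables, once Tonelli brings that
    coordinate to the innermost place.  The constant is [1] for an orthogonal
    matrix because the Gaussian density is rotation invariant with mass [1].

    No measurability of [g1] is assumed, but the set where an arbitrary function
    is differentiable is Borel (a countable intersection of countable unions of
    closed sets), and so is its gradient there; the remaining null set,
    which the affine map [z |-> L1 z + mu1] preserves, is harmless since the
    one-dimensional measures are complete. *)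

Set Implicit Arguments.
Unset Strict Implicit.
Unset Printing Implicit Defensive.

Import Order.TTheory GRing.Theory Num.Theory.
Import numFieldNormedType.Exports.
Local Open Scope classical_set_scope.
Local Open Scope ring_scope.

(** * Affine change of variable on the line *)

Section completed_lebesgue.
Variable R : realType.
Local Notation lambda := (@completed_lebesgue_measure R).

(** Borel sets are Caratheodory measurable; this identity carries Borel functions over to the
    completed line. *)
Lemma measurable_completed_id :
  measurable_fun [set: caratheodory_type (wlength idfun)^*%mu]
    (fun t => t : measurableTypeR R).
Proof. by move=> _ B mB; rewrite setTI; exact: sub_caratheodory. Qed.

Lemma measurable_affine (a b : R) :
  measurable_fun [set: caratheodory_type (wlength idfun)^*%mu]
    (fun t => a * t + b : measurableTypeR R).
Proof.
apply: measurable_funD => //; apply: measurable_funM => //.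
exact: measurable_completed_id.
Qed.

Lemma completed_lebesgue_itv (i : interval R) :
  lambda [set` i] = lebesgue_measure [set` i].
Proof. by []. Qed.

(** By uniqueness of Lebesgue measure it suffices that [|a|] times the image of the completed
    measure under [t |-> a t + b] gives half-open intervals their length. *)
Lemma pushforward_affine (a b : R) (A : set R) : a != 0 -> measurable A ->
  lebesgue_measure A = (`|a|%:E * lambda [set t : R | A (a * t + b)%R])%E.
Proof.
move=> a0 mA.
pose phi (t : caratheodory_type (@wlength R idfun)^*%mu) : measurableTypeR R :=
  a * t + b.
have mphi : measurable_fun setT phi by exact: measurable_affine.
pose nu := mscale (NngNum (normr_ge0 a))
  (measure_function_pushforward__canonical__measure_function_Measure lambda mphi).
have nuE X : nu X = (`|a|%:E * lambda [set t : R | X (a * t + b)%R])%E.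
  by rewrite /nu/= /mscale.
rewrite -[RHS]nuE.
apply: lebesgue_measure_unique => // _ [[x y] _ <-]; rewrite [RHS]nuE/=.
rewrite lebesgue_measure_itv/= lte_fin -EFinD.
case: (ltrgtP a 0) a0 => // a0 _; [rewrite ltr0_norm|rewrite gtr0_norm]=> //.
(* For [a < 0] the endpoints swap and the closed end changes side; the length is unaffected. *)
- rewrite (_ : [set t | _] = [set` `[(y - b) / a, (x - b) / a[]); last first.
    apply/seteqP; split => t /=; rewrite !in_itv/= ler_ndivrMr// ltr_ndivlMr//;
      rewrite [t * a]mulrC lerBrDr ltrBlDr andbC; by [].
  rewrite completed_lebesgue_itv lebesgue_measure_itv/= lte_fin.
  rewrite ltr_nM2r ?invr_lt0// ltrD2r; case: ifP => _; rewrite ?mule0//.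
  by rewrite -EFinD -EFinM; congr EFin; field; rewrite lt_eqF.
- rewrite (_ : [set t | _] = [set` `](x - b) / a, (y - b) / a]]); last first.
    apply/seteqP; split => t /=; rewrite !in_itv/= ler_pdivlMr// ltr_pdivrMr//;
      rewrite [t * a]mulrC lerBrDr ltrBlDr; by [].
  rewrite completed_lebesgue_itv lebesgue_measure_itv/= lte_fin.
  rewrite ltr_pM2r ?invr_gt0// ltrD2r; case: ifP => _; rewrite ?mule0//.
  by rewrite -EFinD -EFinM; congr EFin; field; rewrite gt_eqF.
Qed.

Local Open Scope ereal_scope.

Lemma integral_affine (a b : R) (f : R -> \bar R) : (a != 0)%R ->
  measurable_fun setT f -> (forall t, 0 <= f t) ->
  \int[lebesgue_measure]_t f t = `|a|%:E * \int[lambda]_t f (a * t + b)%R.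
Proof.
move=> a0 mf f0.
pose phi (t : caratheodory_type (@wlength R idfun)^*%mu) : measurableTypeR R :=
  (a * t + b)%R.
have mphi : measurable_fun setT phi by exact: measurable_affine.
pose nu := mscale (NngNum (normr_ge0 a))
  (measure_function_pushforward__canonical__measure_function_Measure lambda mphi).
rewrite (@eq_measure_integral _ _ _ setT nu) => [|A mA _]; last first.
  exact: (pushforward_affine b a0 mA).
rewrite ge0_integral_mscale//=; congr (_ * _).
rewrite ge0_integral_pushforward//; exact: measurable_affine.
Qed.

Lemma completed_integral_affine (a b : R) (f : R -> \bar R) : (a != 0)%R ->
  measurable_fun setT f -> (forall t, 0 <= f t) ->
  \int[lambda]_t f (a * t + b)%R = (`|a|^-1)%:E * \int[lambda]_t f t.
Proof.
move=> a0 mf f0.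
(* The case [a = 1], [b = 0] identifies the completed integral with the Borel one. *)
have -> : \int[lambda]_t f t = \int[lebesgue_measure]_t f t.
  rewrite (@integral_affine 1 0 f)// normr1 mul1e.
  by apply: eq_integral => t _; rewrite mul1r addr0.
rewrite (@integral_affine a b f a0 mf f0) muleA -EFinM mulVf ?mul1e//.
by rewrite normr_eq0.
Qed.

End completed_lebesgue.

(** * Iterated integrals *)

(** Since [h] may change sign, Tonelli is applied to its positive and negative parts separately. *)
Lemma measurable_integral_param d1 d2 (T1 : measurableType d1)
    (T2 : measurableType d2) (R : realType)
    (m2 : {sigma_finite_measure set T2 -> \bar R}) (h : T1 * T2 -> \bar R) :
  measurable_fun setT h ->
  measurable_fun setT (fun x => \int[m2]_y h (x, y))%E.
Proof.
move=> mh; under eq_fun do rewrite integralE.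
apply: emeasurable_funB.
- have := @measurable_fun_fubini_tonelli_F _ _ _ _ _ m2 _
    (measurable_funepos mh) (funepos_ge0 h).
  apply: eq_measurable_fun => x _.
  by apply: eq_integral => y _; rewrite !funeposE.
- have := @measurable_fun_fubini_tonelli_F _ _ _ _ _ m2 _
    (measurable_funeneg mh) (funeneg_ge0 h).
  apply: eq_measurable_fun => x _.
  by apply: eq_integral => y _; rewrite !funenegE.
Qed.

Section jointly_measurable.
Variable R : realType.

(** Measurability on a space [S] with real coordinates [c], tested against all
    measurable families of points; this dispenses with a sigma-algebra on [S]. *)
Definition jmeasurable (I S : Type) (c : I -> S -> R) d' (T' : measurableType d')
    (f : S -> T') : Prop :=
  forall d (T : measurableType d) (X : T -> S),
    (forall i, measurable_fun setT (fun t => c i (X t) : measurableTypeR R)) ->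
    measurable_fun setT (fun t => f (X t)).

Definition seq_coord (i : nat) (x : nat -> R) : R := x i.

Definition upd (x : nat -> R) (k : nat) (t : R) : nat -> R :=
  fun i => if i == k then t else x i.

Lemma updC x i j s t : i != j -> upd (upd x i s) j t = upd (upd x j t) i s.
Proof.
move=> ij; apply/funext => k; rewrite /upd.
by case: (eqVneq k j) => // ->; rewrite eq_sym (negbTE ij).
Qed.

End jointly_measurable.

Notation smeasurable := (jmeasurable (@seq_coord _)).

Section iterated_integral.
Variable R : realType.
Local Notation lambda := (@completed_lebesgue_measure R).
Implicit Types (w : R -> R) (F G : (nat -> R) -> \bar R) (x y : nat -> R).
Local Open Scope ereal_scope.

(** With the weight as a parameter, Gaussian expectation and plain Lebesgue integration are two
    instances of one construction. *)
Fixpoint iter_int w (n : nat) F x : \bar R :=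
  match n with
  | 0 => F x
  | k.+1 => \int[lambda]_t ((w t)%:E * iter_int w k F (upd x k t))
  end.

Lemma smeasurable_upd d (T : measurableType d) F (X : T -> nat -> R) k :
  smeasurable F -> (forall i, measurable_fun setT (fun t => X t i : measurableTypeR R)) ->
  measurable_fun setT
    (fun p : T * caratheodory_type (wlength idfun)^*%mu => F (upd (X p.1) k p.2)).
Proof.
move=> mF mX; apply: mF => i; rewrite /seq_coord /upd.
case: (eqVneq i k) => _.
- by apply: (measurableT_comp (@measurable_completed_id R)); exact: measurable_snd.
- by apply: (measurableT_comp (mX i)); exact: measurable_fst.
Qed.

Variable w : R -> R.
Hypothesis mw : measurable_fun setT (w : measurableTypeR R -> measurableTypeR R).
Hypothesis w0 : forall t, (0 <= w t)%R.

Lemma measurable_weight :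
  measurable_fun [set: caratheodory_type (wlength idfun)^*%mu] (fun t => (w t)%:E).
Proof.
apply/measurable_EFinP.
exact: (measurableT_comp mw (@measurable_completed_id R)).
Qed.

Lemma smeasurable_updt F x k : smeasurable F ->
  measurable_fun [set: caratheodory_type (wlength idfun)^*%mu]
    (fun t => F (upd x k t)).
Proof.
move=> mF; apply: mF => i; rewrite /seq_coord /upd.
by case: (eqVneq i k) => _; [exact: measurable_completed_id|exact: measurable_cst].
Qed.

(** The Borel version is what the affine change of variable on the line asks for. *)
Lemma smeasurable_updtB F x k : smeasurable F ->
  measurable_fun setT (fun t : measurableTypeR R => F (upd x k t)).
Proof.
move=> mF; apply: mF => i; rewrite /seq_coord /upd.
by case: (eqVneq i k) => _; [exact: measurable_id|exact: measurable_cst].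
Qed.

Lemma smeasurable_integrand F x k : smeasurable F ->
  measurable_fun [set: caratheodory_type (wlength idfun)^*%mu]
    (fun t => (w t)%:E * F (upd x k t)).
Proof.
move=> mF; apply: emeasurable_funM; first exact: measurable_weight.
exact: smeasurable_updt.
Qed.

Lemma smeasurable_iter_int n F : smeasurable F -> smeasurable (iter_int w n F).
Proof.
move=> mF; elim: n => //= k IH d T X mX.
apply: (@measurable_integral_param _ _ _ _ _ lambda
  (fun p => (w p.2)%:E * iter_int w k F (upd (X p.1) k p.2))).
apply: emeasurable_funM; last exact: smeasurable_upd.
exact: (measurableT_comp measurable_weight measurable_snd).
Qed.

Lemma iter_int_ge0 n F x : (forall y, 0 <= F y) -> 0 <= iter_int w n F x.
Proof.
move=> F0; elim: n x => //= k IH x; apply: integral_ge0 => t _.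
by rewrite mule_ge0// lee_fin.
Qed.

Lemma integrand_ge0 n F x t : (forall y, 0 <= F y) ->
  0 <= (w t)%:E * iter_int w n F x.
Proof. by move=> F0; apply: mule_ge0; [rewrite lee_fin|exact: iter_int_ge0]. Qed.

Lemma ge0_iter_intZl n F x (k : \bar R) : smeasurable F -> (forall y, 0 <= F y) -> 0 <= k ->
  iter_int w n (fun y => k * F y) x = k * iter_int w n F x.
Proof.
move=> mF F0 k0; elim: n x => //= n IH x.
under eq_integral do rewrite IH muleCA.
apply: ge0_integralZl => [|||]; first exact: measurableT.
- exact: smeasurable_integrand (smeasurable_iter_int _ _).
- by move=> t _; apply: integrand_ge0.
- exact: k0.
Qed.

Lemma le_iter_int n F G x : smeasurable F -> smeasurable G -> (forall y, 0 <= F y) ->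
  (forall y, F y <= G y) -> iter_int w n F x <= iter_int w n G x.
Proof.
move=> mF mG F0 FG; elim: n x => //= n IH x.
apply: ge0_le_integral => [||||t _]; first exact: measurableT.
- by move=> t _; apply: integrand_ge0.
- exact: smeasurable_integrand (smeasurable_iter_int _ _).
- exact: smeasurable_integrand (smeasurable_iter_int _ _).
- by apply: lee_wpmul2l; [rewrite lee_fin|exact: IH].
Qed.

(** The [n] integrals only overwrite coordinates below [n], so a factor depending on coordinate
    [j >= n] is a constant for them. *)
Lemma iter_int_pull n F x j (u : R -> \bar R) : (n <= j)%N ->
  (forall t, 0 <= u t) -> smeasurable F -> (forall y, 0 <= F y) ->
  iter_int w n (fun y => u (y j) * F y) x = u (x j) * iter_int w n F x.
Proof.
move=> nj u0 mF F0; elim: n nj x => //= n IH nj x.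
under eq_integral => t _.
  rewrite IH 1?ltnW// /upd gtn_eqF// muleCA.
  over.
apply: ge0_integralZl => [|||]; first exact: measurableT.
- exact: smeasurable_integrand (smeasurable_iter_int _ _).
- by move=> t _; apply: integrand_ge0.
- exact: u0.
Qed.

Lemma smeasurable_int F i : smeasurable F ->
  smeasurable (fun y => \int[lambda]_t F (upd y i t)).
Proof.
move=> mF d T X mX.
exact: (@measurable_integral_param _ _ _ _ _ lambda _ (smeasurable_upd i mF mX)).
Qed.

(** Tonelli swaps the integral over coordinate [i] with one level at a time, until it reaches the
    innermost place. *)
Lemma iter_int_comm n F x i : (n <= i)%N -> smeasurable F -> (forall y, 0 <= F y) ->
  \int[lambda]_t iter_int w n F (upd x i t) =
  iter_int w n (fun y => \int[lambda]_t F (upd y i t)) x.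
Proof.
move=> ni mF F0; elim: n ni x => //= n IH ni x.
have mupd : forall j, measurable_fun [set: caratheodory_type (wlength idfun)^*%mu]
    (fun t => upd x i t j : measurableTypeR R).
  by move=> j; rewrite /upd; case: (eqVneq j i) => _;
    [exact: measurable_completed_id|exact: measurable_cst].
rewrite (@fubini_tonelli _ _ _ _ _ lambda lambda (fun p =>
  (w p.2)%:E * iter_int w n F (upd (upd x i p.1) n p.2)))/=; last 2 first.
- apply: emeasurable_funM.
    exact: (measurableT_comp measurable_weight measurable_snd).
  exact: (smeasurable_upd n (smeasurable_iter_int n mF) mupd).
- by move=> p; apply: integrand_ge0.
apply: eq_integral => s _; rewrite -IH; last exact: ltnW.
under eq_integral do rewrite updC ?gtn_eqF//.
apply: ge0_integralZl => [||t _|]; first exact: measurableT.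
- exact: smeasurable_updt (smeasurable_iter_int _ _).
- exact: iter_int_ge0.
- by rewrite lee_fin.
Qed.

End iterated_integral.

(** * Almost everywhere equality and linearity for positive weights *)

Section weighted_iterated_integral.
Variable R : realType.
Local Notation lambda := (@completed_lebesgue_measure R).
Implicit Types (F G : (nat -> R) -> \bar R) (x y : nat -> R).
Local Open Scope ereal_scope.
Variable w : R -> R.
Hypothesis mw : measurable_fun setT (w : measurableTypeR R -> measurableTypeR R).
Hypothesis w_gt0 : forall t, (0 < w t)%R.

Let w0 t : (0 <= w t)%R. Proof. exact: ltW. Qed.

(** [F] need not be measurable: completeness of the one-dimensional measure
    is what makes its iterated integral agree with that of [F']. *)
Lemma iter_int_ae n G F F' x : smeasurable G -> smeasurable F' ->
  (forall y, 0 <= G y) -> (forall y, G y = 0 -> F y = F' y) ->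
  iter_int w n G x = 0 -> iter_int w n F x = iter_int w n F' x.
Proof.
move=> mG mF' G0 GF; elim: n x => [x|n IH x]; first exact: GF.
move=> /= iG0.
have mGn := smeasurable_integrand mw x n (smeasurable_iter_int mw n mG).
have mFn := smeasurable_integrand mw x n (smeasurable_iter_int mw n mF').
(* A nonnegative integrand with zero integral vanishes almost everywhere; as [w t > 0], the inner
   iterated integral of [G] vanishes there, which is the premise of the induction hypothesis. *)
have aeG : ae_eq lambda setT
    (fun t => (w t)%:E * iter_int w n G (upd x n t)) (cst 0).
  apply/(ae_eq_integral_abs _ measurableT mGn); rewrite -[RHS]iG0.
  by apply: eq_integral => t _; rewrite gee0_abs//; exact: integrand_ge0.
have aeF : ae_eq lambda setT (fun t => (w t)%:E * iter_int w n F' (upd x n t))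
    (fun t => (w t)%:E * iter_int w n F (upd x n t)).
  move: aeG; apply: filterS => t + _ => /(_ I)/eqP.
  rewrite mule_eq0 eqe gt_eqF// => /eqP Gt.
  by rewrite (IH _ Gt).
apply: ae_eq_integral (ae_eq_sym aeF) => [||]; [exact: measurableT| |exact: mFn].
exact: (ae_measurable_fun (@completed_lebesgue_measure_is_complete R) aeF).
Qed.

Lemma smeasurable_abse F : smeasurable F -> smeasurable (fun y => `|F y|).
Proof.
by move=> mF d T X mX; apply: measurableT_comp => //; exact: mF.
Qed.

Lemma abse_iter_int_le n F x : smeasurable F ->
  `|iter_int w n F x| <= iter_int w n (fun y => `|F y|) x.
Proof.
move=> mF; elim: n x => //= n IH x.
have mFn := smeasurable_integrand mw x n (smeasurable_iter_int mw n mF).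
apply: le_trans (le_abse_integral _ measurableT mFn) _.
apply: ge0_le_integral => [||||t _]; first exact: measurableT.
- by move=> t _; exact: abse_ge0.
- exact: measurableT_comp.
- exact: smeasurable_integrand (smeasurable_iter_int _ _ (smeasurable_abse mF)).
- rewrite abseM gee0_abs; last by rewrite lee_fin.
  by apply: lee_wpmul2l; [rewrite lee_fin|exact: IH].
Qed.

(** An integrable function is finite almost everywhere, and a positive weight cannot hide an
    infinite inner integral. *)
Lemma iter_int_lty_ae n F x : smeasurable F ->
  iter_int w n.+1 (fun y => `|F y|) x < +oo ->
  {ae lambda, forall t, iter_int w n (fun y => `|F y|) (upd x n t) < +oo}.
Proof.
move=> mF /= Foo.
have mA := smeasurable_integrand mw x n (smeasurable_iter_int mw n (smeasurable_abse mF)).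
have /integrable_ae-/(_ measurableT) : lambda.-integrable setT
    (fun t => (w t)%:E * iter_int w n (fun y => `|F y|) (upd x n t)).
  apply/integrableP; split => //; move: Foo; congr (_ < _).
  apply: eq_integral => t _; rewrite gee0_abs//; apply: integrand_ge0 => // y.
apply: filterS => t /(_ I).
rewrite ge0_fin_numE; last by apply: integrand_ge0.
case E : (iter_int w n _ _) => [r| |]; rewrite ?ltry ?ltNyr//.
by rewrite gt0_muley ?lte_fin.
Qed.

Lemma integrable_iter_int n F x : smeasurable F ->
  iter_int w n.+1 (fun y => `|F y|) x < +oo ->
  lambda.-integrable setT (fun t => (w t)%:E * iter_int w n F (upd x n t)).
Proof.
move=> mF /= Foo; have mFn := smeasurable_integrand mw x n (smeasurable_iter_int mw n mF).
apply/integrableP; split=> //; apply: le_lt_trans Foo.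
apply: ge0_le_integral => [||||t _]; first exact: measurableT.
- by move=> t _; exact: abse_ge0.
- exact: measurableT_comp.
- exact: smeasurable_integrand (smeasurable_iter_int _ _ (smeasurable_abse mF)).
- rewrite abseM gee0_abs; last by rewrite lee_fin.
  by apply: lee_wpmul2l; [rewrite lee_fin|exact: abse_iter_int_le].
Qed.

(** At each level the inner integrals may be infinite for exceptional values of the outer variable,
    so the induction hypothesis is available only almost everywhere. *)
Lemma iter_intD n F G x : smeasurable F -> smeasurable G ->
  iter_int w n (fun y => `|F y|) x < +oo -> iter_int w n (fun y => `|G y|) x < +oo ->
  iter_int w n (fun y => F y + G y) x = iter_int w n F x + iter_int w n G x.
Proof.
move=> mF mG; have mFG : smeasurable (fun y => F y + G y).
  by move=> d T X mX; apply: emeasurable_funD; [exact: mF|exact: mG].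
elim: n x => [//|n IH] x Foo Goo.
have iF := integrable_iter_int mF Foo; have iG := integrable_iter_int mG Goo.
rewrite /= -(integralD measurableT iF iG).
apply: ae_eq_integral => [|||]; first exact: measurableT.
- exact: smeasurable_integrand (smeasurable_iter_int _ _ mFG).
- apply: emeasurable_funD.
  + exact: smeasurable_integrand (smeasurable_iter_int _ _ mF).
  + exact: smeasurable_integrand (smeasurable_iter_int _ _ mG).
- have Fae := iter_int_lty_ae mF Foo; have := iter_int_lty_ae mG Goo.
  have fae := ae_filter_ringOfSetsType lambda.
  apply: filterS2 Fae => t Ft Gt _; rewrite IH// muleDr//.
  (* Distributing the weight requires the sum to be defined; finiteness of the second term is
     enough. *)
  apply: fin_num_adde_defl; rewrite fin_num_abs.
  by apply: le_lt_trans Gt; exact: abse_iter_int_le.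
Qed.

Lemma iter_intZ n F x (a : R) : smeasurable F ->
  iter_int w n (fun y => `|F y|) x < +oo ->
  iter_int w n (fun y => a%:E * F y) x = a%:E * iter_int w n F x.
Proof.
move=> mF; have maF : smeasurable (fun y => a%:E * F y).
  by move=> d T X mX; apply: emeasurable_funM; [exact: measurable_cst|exact: mF].
elim: n x => [//|n IH] x Foo.
have iF := integrable_iter_int mF Foo.
rewrite /= -(integralZl measurableT iF).
apply: ae_eq_integral => [|||]; first exact: measurableT.
- exact: smeasurable_integrand (smeasurable_iter_int _ _ maF).
- apply: emeasurable_funM; first exact: measurable_cst.
  exact: smeasurable_integrand (smeasurable_iter_int _ _ mF).
- have := iter_int_lty_ae mF Foo.
  have fae := ae_filter_ringOfSetsType lambda.
  by apply: filterS => t Ft _; rewrite IH// muleCA.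
Qed.

End weighted_iterated_integral.

(** * Unweighted iterated integrals and densities *)

Section lebesgue_iterated_integral.
Variable R : realType.
Local Notation lambda := (@completed_lebesgue_measure R).
Implicit Types (F G : (nat -> R) -> \bar R) (x y : nat -> R).
Local Open Scope ereal_scope.

Definition leb_int := iter_int (fun _ : R => 1%R).

Let m1 : measurable_fun setT ((fun _ => 1%R) : measurableTypeR R -> measurableTypeR R).
Proof. exact: measurable_cst. Qed.

Let ge01 (t : R) : (0 <= 1 :> R)%R. Proof. exact: ler01. Qed.

Lemma leb_intS n F x : leb_int n.+1 F x = \int[lambda]_t leb_int n F (upd x n t).
Proof. by rewrite /leb_int/=; apply: eq_integral => t _; rewrite mul1e. Qed.

(** The levels above [i] are peeled off by linearity; once [i] is outermost, it is commuted to the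
    innermost place, where the one-dimensional hypothesis applies. *)
Lemma leb_int_coord n F F' x i (c : \bar R) : (i < n)%N -> 0 <= c ->
  smeasurable F -> smeasurable F' -> (forall y, 0 <= F y) -> (forall y, 0 <= F' y) ->
  (forall y, \int[lambda]_t F' (upd y i t) = c * \int[lambda]_t F (upd y i t)) ->
  leb_int n F' x = c * leb_int n F x.
Proof.
move=> ni c0 mF mF' F0 F'0 FF'; elim: n ni x => // n IH; rewrite ltnS leq_eqVlt.
case/orP => [/eqP <-{IH} x|/IH {}IH x].
  rewrite !leb_intS /leb_int !(iter_int_comm m1)//.
  rewrite -(ge0_iter_intZl m1)//; [|exact: smeasurable_int|].
    by congr iter_int; apply/funext.
  by move=> y; apply: integral_ge0.
rewrite !leb_intS; under eq_integral do rewrite IH.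
apply: ge0_integralZl => [||t _|]; first exact: measurableT.
- exact: smeasurable_updt (smeasurable_iter_int m1 n mF).
- exact: iter_int_ge0.
- exact: c0.
Qed.

Section density.
Variable w : R -> R.
Hypothesis mw : measurable_fun setT (w : measurableTypeR R -> measurableTypeR R).
Hypothesis w0 : forall t, (0 <= w t)%R.

Lemma smeasurable_density n F : smeasurable F ->
  smeasurable (fun y => (\prod_(i < n) w (y i))%:E * F y).
Proof.
move=> mF d T X mX; apply: emeasurable_funM; last exact: mF.
apply/measurable_EFinP; elim: n => [|n IH].
  by under eq_fun do rewrite big_ord0; exact: measurable_cst.
under eq_fun do rewrite big_ord_recr/=.
by apply: measurable_funM; [exact: IH|exact: measurableT_comp mw (mX n)].
Qed.

Lemma density_ge0 n F y : (forall y, 0 <= F y) ->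
  0 <= (\prod_(i < n) w (y i))%:E * F y.
Proof. by move=> F0; rewrite mule_ge0// lee_fin prodr_ge0. Qed.

(** The weight of each level is pulled inside the lower integrals, so that all weights gather into
    one product density. *)
Lemma iter_int_density n F x : smeasurable F -> (forall y, 0 <= F y) ->
  iter_int w n F x = leb_int n (fun y => (\prod_(i < n) w (y i))%:E * F y) x.
Proof.
move=> mF F0; elim: n x => [x|n IH x].
  by rewrite /leb_int/= big_ord0 mul1e.
rewrite leb_intS/=; apply: eq_integral => t _; rewrite IH.
(* Reading [t] as coordinate [n] of the updated sequence gives the weight the form [iter_int_pull]
   expects. *)
rewrite [w t](_ : _ = w (upd x n t n)); last by rewrite /upd eqxx.
rewrite -(@iter_int_pull _ _ m1 ge01 _ _ _ n (fun t => (w t)%:E))//.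
- congr iter_int; apply/funext => y; rewrite big_ord_recr/= EFinM.
  by rewrite muleA [in RHS](muleC _ (w _)%:E).
- exact: smeasurable_density.
- by move=> y; exact: density_ge0.
Qed.

End density.

End lebesgue_iterated_integral.

(** * Linear change of variables *)

Section vectors.
Variables (R : realType) (d : nat).

Definition vec_coord (i : 'I_d) (z : 'cV[R]_d) : R := z i 0.

Definition vec (x : nat -> R) : 'cV[R]_d := \col_(i < d) x i.

Lemma vec_upd x (i : 'I_d) t :
  vec (upd x i t) = \col_j (if j == i then t else x j).
Proof. by apply/colP => j; rewrite !mxE /upd -val_eqE. Qed.

End vectors.

Notation vmeasurable := (jmeasurable (@vec_coord _ _)).

Section lebesgue_vector.
Variables (R : realType) (d : nat).
Implicit Types (f : 'cV[R]_d -> \bar R) (phi : 'cV[R]_d -> 'cV[R]_d).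

Lemma vmeasurable_coord (i : 'I_d) :
  vmeasurable (fun z => z i 0 : measurableTypeR R).
Proof. by move=> d' T X mX; exact: mX. Qed.

Lemma vmeasurable_comp phi d' (T' : measurableType d') (f : 'cV[R]_d -> T') :
  (forall i, vmeasurable (fun z => phi z i 0 : measurableTypeR R)) ->
  vmeasurable f -> vmeasurable (f \o phi).
Proof.
move=> mphi mf d'' T X mX.
by apply: (mf _ _ (fun t => phi (X t))) => i; exact: mphi.
Qed.

Lemma smeasurable_vec d' (T' : measurableType d') (f : 'cV[R]_d -> T') :
  vmeasurable f -> smeasurable (fun x => f (vec d x)).
Proof.
move=> mf d'' T X mX; apply: (mf _ _ (fun t => vec d (X t))) => i.
by rewrite /vec_coord; under eq_fun do rewrite mxE; exact: mX.
Qed.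

Lemma vmeasurable_lin (J : finType) (P : pred J) (a : J -> R)
    (u : J -> 'cV[R]_d -> R) :
  (forall j, vmeasurable (u j : _ -> measurableTypeR R)) ->
  vmeasurable (fun z => \sum_(j | P j) a j * u j z : measurableTypeR R).
Proof.
move=> mu d' T X mX; under eq_fun do rewrite -big_filter.
apply: measurable_sum => j.
by apply: measurable_funM; [exact: measurable_cst|exact: mu].
Qed.

Local Open Scope ereal_scope.

Definition leb_exp f := leb_int d (fun x => f (vec d x)) (fun _ => 0%R).

(** The factor [c] is existential because its value is never computed: for orthogonal maps it will
    follow from the total mass of the Gaussian. *)
Definition scales_lebesgue phi : Prop :=
  (forall i, vmeasurable (fun z => phi z i 0%R : measurableTypeR R)) /\
  exists2 c : R, (0 < c)%R &
    forall f, vmeasurable f -> (forall z, 0 <= f z) ->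
      leb_exp (f \o phi) = c%:E * leb_exp f.

Lemma scales_lebesgue_id : scales_lebesgue id.
Proof.
split; first exact: vmeasurable_coord.
by exists 1%R => // f mf f0; rewrite mul1e.
Qed.

Lemma scales_lebesgue_comp phi psi :
  scales_lebesgue phi -> scales_lebesgue psi -> scales_lebesgue (phi \o psi).
Proof.
move=> [mphi [a a0 aE]] [mpsi [b b0 bE]]; split.
  by move=> i; exact: (vmeasurable_comp mpsi (mphi i)).
exists (b * a)%R; first exact: mulr_gt0.
move=> f mf f0; rewrite (bE (f \o phi)); last by move=> z; exact: f0.
  by rewrite aE// EFinM muleA.
exact: vmeasurable_comp.
Qed.

(** With the other coordinates frozen, this is an affine map of the line of slope [r]; its offset
    [b z] is a constant because [b] ignores coordinate [i]. *)
Lemma scales_lebesgue_coord (i : 'I_d) (r : R) (b : 'cV[R]_d -> R) :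
  (r != 0)%R -> vmeasurable (b : _ -> measurableTypeR R) ->
  (forall z z' : 'cV[R]_d, (forall j, j != i -> z j 0 = z' j 0)%R -> b z = b z') ->
  scales_lebesgue
    (fun z => (\col_j (if j == i then r * z i 0 + b z else z j 0))%R).
Proof.
move=> r0 mb bi; set phi := fun z => _.
have mphi j : vmeasurable (fun z => phi z j 0%R : measurableTypeR R).
  move=> d' T X mX; under eq_fun do rewrite mxE.
  case: (eqVneq j i) => _; last exact: mX.
  apply: measurable_funD; last exact: mb.
  by apply: measurable_funM; [exact: measurable_cst|exact: mX].
split=> //; exists (`|r|^-1)%R; first by rewrite invr_gt0 normr_gt0.
move=> f mf f0; apply: (@leb_int_coord _ _ _ _ _ i) => //.
- exact: smeasurable_vec.
- by apply: (smeasurable_vec (f := f \o phi)); exact: vmeasurable_comp.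
- by move=> y; exact: f0.
move=> y; have mfy := smeasurable_updtB y i (smeasurable_vec mf).
rewrite -(completed_integral_affine (b (vec d y)) r0 mfy); last by move=> t; exact: f0.
apply: eq_integral => t _; congr f; rewrite !vec_upd /phi.
apply/colP => j; rewrite !mxE; case: (eqVneq j i) => [ji|//].
rewrite eqxx; congr (_ + _)%R; apply: bi => k ki.
by rewrite !mxE (negbTE ki).
Qed.

(** The translation is built one coordinate at a time: [phi k] shifts the first [k] coordinates. *)
Lemma scales_lebesgue_shift (v : 'cV[R]_d) : scales_lebesgue (fun z => z + v)%R.
Proof.
pose phi k (z : 'cV[R]_d) : 'cV[R]_d :=
  (\col_i (if (i < k)%N then z i 0 + v i 0 else z i 0))%R.
suff H k : (k <= d)%N -> scales_lebesgue (phi k).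
  have -> : (fun z => z + v)%R = phi d; last exact: H.
  by apply/funext => z; apply/colP => i; rewrite !mxE ltn_ord.
elim: k => [_|k IH kd].
  have -> : phi 0%N = id; last exact: scales_lebesgue_id.
  by apply/funext => z; apply/colP => i; rewrite mxE.
pose i0 := Ordinal kd.
have mc : vmeasurable ((fun _ => v i0 0%R) : 'cV[R]_d -> measurableTypeR R).
  by move=> d' T X mX; exact: measurable_cst.
have := scales_lebesgue_comp
  (@scales_lebesgue_coord i0 1%R _ (oner_neq0 _) mc (fun _ _ _ => erefl)) (IH (ltnW kd)).
congr scales_lebesgue; apply/funext => z; apply/colP => i; rewrite !mxE.
case: (eqVneq i i0) => [->|ii0]; first by rewrite /= ltnn ltnSn mul1r.
by rewrite ltnS (leq_eqVlt i k) (_ : (i == k :> nat) = false)//; apply/negbTE.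
Qed.

Definition mx_scales (A : 'M[R]_d) := scales_lebesgue (mulmx A).

Lemma mx_scalesM A B : mx_scales A -> mx_scales B -> mx_scales (A *m B)%R.
Proof.
move=> gA gB; have := scales_lebesgue_comp gA gB; congr scales_lebesgue.
by apply/funext => z /=; rewrite mulmxA.
Qed.

Lemma scales_lebesgue_row (A : 'M[R]_d) i : (A i i != 0)%R ->
  scales_lebesgue (fun z => (\col_j (if j == i then (A *m z) i 0 else z j 0))%R).
Proof.
move=> Aii; pose b (z : 'cV[R]_d) : R := (\sum_(k | k != i) A i k * z k 0)%R.
have mb : vmeasurable (b : _ -> measurableTypeR R).
  by apply: vmeasurable_lin => j; exact: vmeasurable_coord.
have bi (z z' : 'cV[R]_d) : (forall j, j != i -> z j 0 = z' j 0)%R -> b z = b z'.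
  by move=> zz'; apply: eq_bigr => k ki; rewrite zz'.
have := scales_lebesgue_coord Aii mb bi; congr scales_lebesgue.
apply/funext => z; apply/colP => j; rewrite !mxE; case: eqVneq => // _.
by rewrite [RHS](bigD1 i).
Qed.

(** Rows are replaced one at a time, in the order given by [ord]: when row [i]
    is installed, the coordinates it reads have not been modified yet. *)
Lemma mx_scales_triangular (A : 'M[R]_d) (ord ord' : 'I_d -> 'I_d) :
  cancel ord ord' -> cancel ord' ord -> (forall i, A i i != 0)%R ->
  (forall i j, (ord j < ord i)%N -> A i j = 0)%R -> mx_scales A.
Proof.
move=> ordK ordK' Aii Aij.
pose phi k (z : 'cV[R]_d) : 'cV[R]_d :=
  (\col_i (if (ord i < k)%N then (A *m z) i 0 else z i 0))%R.
suff H k : (k <= d)%N -> scales_lebesgue (phi k).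
  rewrite /mx_scales (_ : mulmx A = phi d); first exact: H.
  by apply/funext => z; apply/colP => i; rewrite [RHS]mxE ltn_ord.
elim: k => [_|k IH kd].
  have -> : phi 0%N = id; last exact: scales_lebesgue_id.
  by apply/funext => z; apply/colP => i; rewrite mxE.
pose i0 := ord' (Ordinal kd).
have oi0 : ord i0 = Ordinal kd by rewrite ordK'.
have := scales_lebesgue_comp (scales_lebesgue_row (Aii i0)) (IH (ltnW kd)).
congr scales_lebesgue; apply/funext => z; apply/colP => i; rewrite [LHS]mxE [RHS]mxE.
case: (eqVneq i i0) => [->|ii0].
  rewrite oi0 /= ltnSn [LHS]mxE [RHS]mxE; apply: eq_bigr => j _.
  (* A coordinate already replaced has [ord j < k = ord i0], so its coefficient in row [i0] is
     zero. *)
  case: (ltnP (ord j) k) => jk; last by rewrite mxE ltnNge jk.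
  by rewrite Aij ?mul0r// oi0.
rewrite mxE ltnS (leq_eqVlt (ord i) k) (_ : (ord i == k :> nat) = false)//.
apply: contra_neqF ii0 => /eqP oik; rewrite -[i]ordK; congr ord'; exact: val_inj.
Qed.

Lemma mx_scales1 : mx_scales 1%:M.
Proof.
rewrite /mx_scales (_ : mulmx _ = id); first exact: scales_lebesgue_id.
by apply/funext => z; rewrite mul1mx.
Qed.

(** A transposition is [(a, b) -> (a+b, b) -> (a+b, a) -> (b, a)]. *)
Lemma mx_scales_tperm (i j : 'I_d) : mx_scales (tperm_mx i j).
Proof.
have [->|ij] := eqVneq i j; first by rewrite /tperm_mx tperm1 perm_mx1; exact: mx_scales1.
pose c (k l : 'I_d) (r e : R) (z : 'cV[R]_d) : 'cV[R]_d :=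
  (\col_m (if m == k then r * z k 0 + e * z l 0 else z m 0))%R.
have gc k l r e : k != l -> (r != 0)%R -> scales_lebesgue (c k l r e).
  move=> kl r0; apply: (scales_lebesgue_coord r0) => [d' T X mX|z z' zz'].
    by apply: measurable_funM; [exact: measurable_cst|exact: mX].
  by rewrite zz'// eq_sym.
have ji : j != i by rewrite eq_sym.
have N1 : (-1 != 0 :> R)%R by rewrite oppr_eq0 oner_eq0.
have := scales_lebesgue_comp (gc i j 1 (-1) ij (oner_neq0 _))%R
  (scales_lebesgue_comp (gc j i (-1) 1 ji N1)%R (gc i j 1 1 ij (oner_neq0 _))%R).
congr scales_lebesgue; apply/funext => z; apply/colP => m.
rewrite /tperm_mx -row_permE /= !mxE !eqxx ?(negbTE ij) ?(negbTE ji) /=.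
case: tpermP => [->|->|/eqP mi /eqP mj]; rewrite ?eqxx ?(negbTE ij) ?(negbTE ji).
- ring.
- ring.
- by rewrite (negbTE mi) (negbTE mj).
Qed.

Lemma mx_scales_perm (s : 'S_d) : mx_scales (perm_mx s).
Proof.
have [ts -> _] := prod_tpermP s.
elim: ts => [|t ts IH]; first by rewrite big_nil perm_mx1; exact: mx_scales1.
rewrite big_cons perm_mxM; apply: mx_scalesM => //; exact: mx_scales_tperm.
Qed.

End lebesgue_vector.

(** The LUP decomposition reduces the claim to a permutation, a unit lower triangular matrix and an
    upper triangular matrix with nonzero diagonal. *)
Lemma mx_scales_unit (R : realType) (d : nat) (A : 'M[R]_d) :
  A \in unitmx -> mx_scales A.
Proof.
case: d A => [|d] A Au.
  by rewrite (_ : A = 1%:M); [exact: mx_scales1|apply/matrixP => -[]].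
have := cormen_lup_correct A.
have := cormen_lup_perm A; have := cormen_lup_lower A; have := cormen_lup_upper A.
case: (cormen_lup A) => [[P L] U] /= Uup Llow /is_perm_mxP[s ->] PA.
have -> : A = perm_mx s^-1 *m (L *m U).
  by rewrite -[L *m U]PA -mulmxE mulmxA -perm_mxM mulVg perm_mx1 mul1mx.
have LUu : L *m U \in unitmx.
  by rewrite -[L *m U]PA -mulmxE unitmx_mul unitmx_perm.
apply: mx_scalesM; first exact: mx_scales_perm.
move: LUu; rewrite unitmx_mul => /andP[_ Uu].
apply: mx_scalesM.
- apply: (@mx_scales_triangular _ _ _ (@rev_ord _) (@rev_ord _)) => [||i|i j].
  + exact: rev_ordK.
  + exact: rev_ordK.
  + by rewrite Llow// eqxx oner_neq0.
  + rewrite /= => ij; have ji : (i < j)%N.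
      by move: ij; rewrite ltn_subLR ?ltn_ord//; have := ltn_ord i; lia.
    rewrite (Llow i j (ltnW ji)); case: (eqVneq i j) ji => [->|//].
    by rewrite ltnn.
- apply: (@mx_scales_triangular _ _ _ id id) => // i.
  (* Transposing makes the upper factor lower triangular, so its determinant is the product of its
     diagonal. *)
  have : \det U^T != 0 by rewrite det_tr -unitfE -unitmxE.
  rewrite det_trig; last first.
    by apply/is_trig_mxP => k l kl; rewrite mxE Uup.
  by move=> /prodf_neq0/(_ i isT); rewrite mxE.
Qed.

Lemma scales_lebesgue_affine (R : realType) (d : nat) (A : 'M[R]_d) (b : 'cV[R]_d) :
  A \in unitmx -> scales_lebesgue (fun z => A *m z + b).
Proof.
by move=> Au; exact: scales_lebesgue_comp (scales_lebesgue_shift b) (mx_scales_unit Au).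
Qed.

(** * Gaussian expectation *)

Section gaussian.
Variables (R : realType) (d : nat).
Local Notation pdf := (@std_normal_pdf R).
Implicit Types (f g : 'cV[R]_d -> \bar R) (phi : 'cV[R]_d -> 'cV[R]_d).

Lemma pdf_gt0 t : 0 < pdf t.
Proof.
by rewrite mulr_gt0 ?expR_gt0// invr_gt0 sqrtr_gt0 mulrn_wgt0// pi_gt0.
Qed.

Lemma pdf_ge0 t : 0 <= pdf t. Proof. exact/ltW/pdf_gt0. Qed.

Lemma normal_pdf01 : normal_pdf 0 1 = pdf.
Proof.
rewrite normal_pdfE ?oner_neq0//; apply/funext => t.
by rewrite /normal_peak /normal_fun /std_normal_pdf subr0 expr1n mul1r.
Qed.

Lemma measurable_pdf : measurable_fun setT (pdf : measurableTypeR R -> measurableTypeR R).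
Proof. by rewrite -normal_pdf01; exact: measurable_normal_pdf. Qed.

Local Open Scope ereal_scope.

Lemma integral_pdf : \int[@completed_lebesgue_measure R]_t (pdf t)%:E = 1.
Proof.
have <- := integral_normal_pdf (0 : R) 1; rewrite normal_pdf01.
have H : measurable_fun setT (fun t : measurableTypeR R => (pdf t)%:E).
  by apply/measurable_EFinP; exact: measurable_pdf.
rewrite (integral_affine 0 (oner_neq0 R) H); last by move=> t; rewrite lee_fin pdf_ge0.
by rewrite normr1 mul1e; apply: eq_integral => t _; rewrite mul1r addr0.
Qed.

Definition gexp f := iter_int pdf d (fun x => f (vec d x)) (fun _ => 0%R).

Lemma gauss_iterE n F x : gauss_iter n F x = iter_int pdf n F x.
Proof. by elim: n x => //= n IH x; apply: eq_integral => t _; rewrite IH. Qed.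

Lemma gauss_expE (h : 'cV[R]_d -> R) : gauss_exp h = gexp (fun z => (h z)%:E).
Proof. exact: gauss_iterE. Qed.

Definition gdens (z : 'cV[R]_d) : R :=
  ((Num.sqrt (pi *+ 2))^-1 ^+ d * expR (- (z^T *m z) 0 0 / 2))%R.

Lemma prod_pdf (x : nat -> R) : (\prod_(i < d) pdf (x i) = gdens (vec d x))%R.
Proof.
rewrite /std_normal_pdf big_split/= prodr_const card_ord -expR_sum; congr (_ * expR _)%R.
rewrite mxE -mulr_suml -sumrN; congr (_ / _)%R; apply: eq_bigr => i _.
by rewrite !mxE expr2.
Qed.

Lemma gdens_gt0 z : (0 < gdens z)%R.
Proof.
by rewrite mulr_gt0 ?expR_gt0// exprn_gt0// invr_gt0 sqrtr_gt0 mulrn_wgt0// pi_gt0.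
Qed.

Lemma gdensM_ge0 f z : (forall z, 0 <= f z) -> 0 <= (gdens z)%:E * f z.
Proof. 
by move=> f0; apply: mule_ge0; [rewrite lee_fin; exact/ltW/gdens_gt0|exact: f0]. Qed.

Lemma gexp_density f : vmeasurable f -> (forall z, 0 <= f z) ->
  gexp f = leb_exp (fun z => (gdens z)%:E * f z).
Proof.
move=> mf f0; rewrite /gexp (iter_int_density measurable_pdf pdf_ge0).
- by congr leb_int; apply/funext => x; rewrite prod_pdf.
- exact: smeasurable_vec.
- by move=> y; exact: f0.
Qed.

Lemma gexp1 : gexp (fun _ => 1) = 1.
Proof.
suff H n x : iter_int pdf n (fun _ => 1) x = 1 by exact: H.
elim: n x => //= n IH x.
by under eq_integral do rewrite IH mule1; exact: integral_pdf.
Qed.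

Lemma vmeasurable_dot : vmeasurable (fun z : 'cV[R]_d => (z^T *m z) 0 0 : measurableTypeR R)%R.
Proof.
move=> d' T X mX; under eq_fun do rewrite mxE.
apply: measurable_sum => i; under eq_fun do rewrite mxE.
by apply: measurable_funM; exact: mX.
Qed.

Lemma vmeasurable_gdens : vmeasurable (gdens : _ -> measurableTypeR R).
Proof.
move=> d' T X mX; apply: measurable_funM; first exact: measurable_cst.
apply: (measurableT_comp (@measurable_expR R)).
apply: measurable_funM; last exact: measurable_cst.
by apply: measurable_funN; exact: vmeasurable_dot.
Qed.

Lemma vmeasurable_gdensM f : vmeasurable f -> vmeasurable (fun z => (gdens z)%:E * f z).
Proof.
move=> mf d' T X mX; apply: emeasurable_funM; last exact: mf.
by apply/measurable_EFinP; exact: vmeasurable_gdens.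
Qed.

Lemma orthogonal_unit (V : 'M[R]_d) : orthogonal_mx V -> V \in unitmx.
Proof. by move=> oV; have [] := mulmx1_unit oV. Qed.

(** The density is invariant under [V], so the Gaussian expectation is scaled by the Lebesgue factor
    [c]; testing on the constant [1] forces [c = 1]. *)
Lemma ge0_gexp_orthogonal (V : 'M[R]_d) f : orthogonal_mx V ->
  vmeasurable f -> (forall z, 0 <= f z) -> gexp (fun z => f (V *m z)%R) = gexp f.
Proof.
move=> oV; have [mV [c c0 cE]] := mx_scales_unit (orthogonal_unit oV).
have gV z : gdens (V *m z)%R = gdens z.
  by rewrite /gdens trmx_mul mulmxA -(mulmxA _ V^T%R) oV mulmx1.
have H g : vmeasurable g -> (forall z, 0 <= g z) ->
    gexp (fun z => g (V *m z)%R) = c%:E * gexp g.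
  move=> mg g0; rewrite (gexp_density mg g0) -cE; last 2 first.
  - exact: vmeasurable_gdensM.
  - by move=> z; exact: gdensM_ge0.
  rewrite gexp_density; last 2 first.
  - exact: (vmeasurable_comp mV mg).
  - by move=> z; exact: g0.
  by congr leb_exp; apply/funext => z /=; rewrite gV.
have c1 : c%:E = 1.
  rewrite -[LHS]mule1 -{1}gexp1 -H ?gexp1//.
by move=> mf f0; rewrite (H f mf f0) c1 mul1e.
Qed.

(** A Gaussian null function is Lebesgue null, and [phi] preserves the latter property. The factor
    [+oo] absorbs the positive density in one direction and dominates it in the other. *)
Lemma gexp_null phi f : scales_lebesgue phi -> vmeasurable f ->
  (forall z, 0 <= f z) -> gexp f = 0 -> gexp (fun z => f (phi z)) = 0.
Proof.
move=> [mphi [c c0 cE]] mf f0 gf0.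
have mfoo : vmeasurable (fun z => +oo * f z).
  by move=> d' T X mX; apply: emeasurable_funM; [exact: measurable_cst|exact: mf].
have foo0 z : 0 <= +oo * f z by apply: mule_ge0.
have m1 : measurable_fun setT ((fun _ => 1%R) : measurableTypeR R -> measurableTypeR R).
  exact: measurable_cst.
have ge01 (t : R) : (0 <= 1 :> R)%R by exact: ler01.
have fphi0 : leb_exp ((fun z => +oo * f z) \o phi) = 0.
  rewrite (cE _ mfoo foo0) (_ : leb_exp _ = +oo * gexp f).
    by rewrite gf0 !mule0.
  rewrite (gexp_density mf f0) -(ge0_iter_intZl m1 ge01).
  - congr iter_int; apply/funext => x; rewrite muleA.
    by rewrite (@gt0_mulye _ (gdens (vec d x))%:E)// lte_fin gdens_gt0.
  - exact: (smeasurable_vec (vmeasurable_gdensM mf)).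
  - by move=> y; exact: gdensM_ge0.
  - exact: leey.
have mfphi := vmeasurable_comp mphi mf.
apply/eqP; rewrite eq_le; apply/andP; split; last by apply: (iter_int_ge0 pdf_ge0).
rewrite gexp_density; [|exact: mfphi|by move=> z; exact: f0].
rewrite -fphi0; apply: (le_iter_int m1 ge01).
- exact: (smeasurable_vec (vmeasurable_gdensM mfphi)).
- exact: (smeasurable_vec (vmeasurable_comp mphi mfoo)).
- by move=> y; apply: (gdensM_ge0 (f := f \o phi)) => z; exact: f0.
- by move=> y /=; apply: lee_wpmul2r; [exact: f0|exact: leey].
Qed.

Lemma le_gexp f g : vmeasurable f -> vmeasurable g -> (forall z, 0 <= f z) ->
  (forall z, f z <= g z) -> gexp f <= gexp g.
Proof.
move=> mf mg f0 fg; apply: (le_iter_int measurable_pdf pdf_ge0).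
- exact: smeasurable_vec.
- exact: smeasurable_vec.
- by move=> y; exact: f0.
- by move=> y; exact: fg.
Qed.

Lemma gexpD f g : vmeasurable f -> vmeasurable g ->
  gexp (fun z => `|f z|) < +oo -> gexp (fun z => `|g z|) < +oo ->
  gexp (fun z => f z + g z) = gexp f + gexp g.
Proof.
rewrite /gexp => mf mg foo goo.
exact: (iter_intD measurable_pdf pdf_gt0 (smeasurable_vec mf) (smeasurable_vec mg)).
Qed.

Lemma gexpZ (a : R) f : vmeasurable f -> gexp (fun z => `|f z|) < +oo ->
  gexp (fun z => a%:E * f z) = a%:E * gexp f.
Proof.
rewrite /gexp => mf foo.
exact: (iter_intZ measurable_pdf pdf_gt0 a (smeasurable_vec mf)).
Qed.

Lemma abse_gexp_le f : vmeasurable f -> `|gexp f| <= gexp (fun z => `|f z|).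
Proof.
move=> mf; rewrite /gexp.
exact: (abse_iter_int_le measurable_pdf pdf_gt0 _ _ (smeasurable_vec mf)).
Qed.

Lemma gexp_ae g f f' : vmeasurable g -> vmeasurable f' -> (forall z, 0 <= g z) ->
  (forall z, g z = 0 -> f z = f' z) -> gexp g = 0 -> gexp f = gexp f'.
Proof.
move=> mg mf' g0 gf; apply: (iter_int_ae measurable_pdf pdf_gt0).
- exact: smeasurable_vec.
- exact: smeasurable_vec.
- by move=> y; exact: g0.
- by move=> y; exact: gf.
Qed.

Lemma vmeasurable_abse f : vmeasurable f -> vmeasurable (fun z => `|f z|).
Proof. by move=> mf d' T X mX; apply: measurableT_comp => //; exact: mf. Qed.

(** For a signed function [gexp] iterates signed integrals, so splitting it into two nonnegative
    expectations rests on additivity under absolute integrability. *)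
Lemma gexp_posneg f : vmeasurable f -> gexp (fun z => `|f z|) < +oo ->
  gexp f = gexp (fun z => maxe (f z) 0) + (-1)%:E * gexp (fun z => maxe (- f z) 0).
Proof.
move=> mf foo.
have mp : vmeasurable (fun z => maxe (f z) 0).
  by move=> d' T X mX; apply: measurable_maxe; [exact: mf|exact: measurable_cst].
have mn : vmeasurable (fun z => maxe (- f z) 0).
  move=> d' T X mX; apply: measurable_maxe; last exact: measurable_cst.
  by apply: measurableT_comp => //; exact: mf.
have mNn : vmeasurable (fun z => (-1)%:E * maxe (- f z) 0).
  by move=> d' T X mX; apply: emeasurable_funM; [exact: measurable_cst|exact: mn].
have le z : `|maxe (f z) 0| <= `|f z| /\ `|maxe (- f z) 0| <= `|f z|.
  split; rewrite gee0_abs ?le_max ?lexx ?orbT// ge_max abse_ge0 andbT.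
    exact: lee_abs.
  by rewrite -abseN; exact: lee_abs.
have poo : gexp (fun z => `|maxe (f z) 0|) < +oo.
  apply: le_lt_trans foo; apply: le_gexp; [exact: vmeasurable_abse|
    exact: vmeasurable_abse|by move=> z; exact: abse_ge0|by move=> z; exact: (le z).1].
have noo : gexp (fun z => `|maxe (- f z) 0|) < +oo.
  apply: le_lt_trans foo; apply: le_gexp; [exact: vmeasurable_abse|
    exact: vmeasurable_abse|by move=> z; exact: abse_ge0|by move=> z; exact: (le z).2].
rewrite -(gexpZ _ mn noo) -gexpD//; last first.
  by move: noo; congr (gexp _ < _); apply/funext => z; rewrite mulN1e abseN.
congr gexp; apply/funext => z; rewrite mulN1e.
by have /(congr1 (@^~ z)) := funeposneg f; rewrite /= funeposE funenegE.
Qed.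

Lemma gexp_orthogonal (V : 'M[R]_d) f : orthogonal_mx V -> vmeasurable f ->
  gexp (fun z => `|f z|) < +oo -> gexp (fun z => f (V *m z)%R) = gexp f.
Proof.
move=> oV mf foo; have [mV _] := mx_scales_unit (orthogonal_unit oV).
have mp : vmeasurable (fun z => maxe (f z) 0).
  by move=> d' T X mX; apply: measurable_maxe; [exact: mf|exact: measurable_cst].
have mn : vmeasurable (fun z => maxe (- f z) 0).
  move=> d' T X mX; apply: measurable_maxe; last exact: measurable_cst.
  by apply: measurableT_comp => //; exact: mf.
rewrite (gexp_posneg mf foo) gexp_posneg; last 2 first.
- exact: (vmeasurable_comp mV mf).
- by rewrite (ge0_gexp_orthogonal oV (vmeasurable_abse mf))// => z; exact: abse_ge0.
rewrite (ge0_gexp_orthogonal oV mp); last by move=> z; rewrite le_max lexx orbT.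
by rewrite (ge0_gexp_orthogonal oV mn)// => z; rewrite le_max lexx orbT.
Qed.

End gaussian.

(** * Differentiability points of an arbitrary function *)

Section affine_approximation.
Variables (R : realType) (d : nat).
Implicit Types (h : 'cV[R]_d -> R) (a b u x y z : 'cV[R]_d) (e del : R).

Definition dotv a u : R := \sum_i a i 0 * u i 0.

Lemma dotv_is_linear a : linear (dotv a).
Proof.
move=> k u v; rewrite /dotv scaler_sumr -big_split/=; apply: eq_bigr => i _.
by rewrite !mxE mulrDr; congr (_ + _); rewrite mulrCA.
Qed.

Lemma dotvZ k a u : dotv a (k *: u) = k * dotv a u.
Proof. by rewrite /dotv mulr_sumr; apply: eq_bigr => i _; rewrite mxE mulrCA. Qed.

Lemma dotvBr a u v : dotv a (u - v) = dotv a u - dotv a v.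
Proof. by rewrite /dotv -sumrB; apply: eq_bigr => i _; rewrite !mxE mulrBr. Qed.

Lemma dotvBl a b u : dotv (a - b) u = dotv a u - dotv b u.
Proof. by rewrite /dotv -sumrB; apply: eq_bigr => i _; rewrite !mxE mulrBl. Qed.

Lemma dotv_e a i : dotv a (e_ R i) = a i 0.
Proof.
rewrite /dotv (bigD1 i)//= mxE !eqxx mulr1 big1 ?addr0// => j ji.
by rewrite mxE (negbTE ji) mulr0.
Qed.

Lemma coord_le_norm u i : `|u i 0| <= `|u|.
Proof.
rewrite [leRHS]/Num.norm/= mx_normrE.
exact: (le_bigmax _ (fun ij : 'I_d * 'I_1 => `|u ij.1 ij.2|) (i, 0)).
Qed.

Lemma norm_e_le (i : 'I_d) : `|e_ R i| <= 1.
Proof.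
rewrite [leLHS]/Num.norm/= mx_normrE; apply/bigmax_leP; split=> // -[j k] _ /=.
by rewrite mxE; case: (_ && _); rewrite ?normr1 ?normr0.
Qed.

Lemma norm_dotv_le a u (c : R) : (forall i, `|a i 0| <= c) ->
  `|dotv a u| <= d%:R * c * `|u|.
Proof.
move=> ac; apply: le_trans (ler_norm_sum _ _ _) _.
apply: (@le_trans _ _ (\sum_(i < d) c * `|u|)).
  by apply: ler_sum => i _; rewrite normrM ler_pM// coord_le_norm.
by rewrite sumr_const card_ord -mulrA mulr_natl.
Qed.

(** Comparing two points near [x], instead of one point with [x], keeps [h x] out of the condition:
    [x] enters only through distances, whence closedness for arbitrary [h]. *)
Definition affine_approx h a e del : set 'cV[R]_d :=
  [set x | forall y y', `|y - x| < del -> `|y' - x| < del ->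
    `|h y - h y' - dotv a (y - y')| <= e * (`|y - x| + `|y' - x|)].

Lemma closed_affine_approx h a e del : 0 <= e -> closed (affine_approx h a e del).
Proof.
move=> e0; rewrite -[X in closed X]setCK; apply: open_closedC; rewrite openE => x /=.
move=> /existsNP[y /existsNP[y' /not_implyP[yx /not_implyP[y'x /negP]]]].
rewrite -ltNge; set s := e * _; set r := `|_| => sr.
(* The first two bounds keep [y] and [y'] within [del] of the new centre; the third keeps the growth
   [2 e |x - w|] of the right-hand side below the gap [r - s]. The [+ 1] covers [e = 0]. *)
pose eta := Num.min (Num.min (del - `|y - x|) (del - `|y' - x|)) ((r - s) / (2 * e + 1)).
have e1 : 0 < 2 * e + 1 by lra.
have eta0 : 0 < eta by rewrite !lt_min !subr_gt0 yx y'x/= divr_gt0// subr_gt0.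
rewrite /interior; apply/(@nbhs_ballP _ 'cV[R]_d); exists eta => // w.
rewrite -ball_normE /= => xw wS.
have tri v : `|v - w| <= `|v - x| + `|x - w|.
  by rewrite (_ : v - w = (v - x) + (x - w)) ?ler_normD// addrA subrK.
move: xw; rewrite !lt_min -andbA => /and3P[xw1 xw2 xw3].
have wy : `|y - w| < del by apply: le_lt_trans (tri y) _; rewrite addrC -ltrBrDr.
have wy' : `|y' - w| < del by apply: le_lt_trans (tri y') _; rewrite addrC -ltrBrDr.
have := wS y y' wy wy'; apply/negP; rewrite -ltNge -/r.
have /le_lt_trans : e * (`|y - w| + `|y' - w|) <= s + e * (2 * `|x - w|).
  by rewrite -mulrDr ler_wpM2l//; have := tri y; have := tri y'; lra.
apply; rewrite ltr_pdivlMr// in xw3; have := normr_ge0 (x - w); nra.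
Qed.

(** Both approximations are tested on the same step [t *: e_ R i] from [x], with [t] inside both
    radii; the slopes then differ by at most [(e + e') t] along it. *)
Lemma affine_approx_close h a b x e e' del del' i : 0 < del -> 0 < del' ->
  0 <= e -> 0 <= e' ->
  affine_approx h a e del x -> affine_approx h b e' del' x ->
  `|a i 0 - b i 0| <= e + e'.
Proof.
move=> del0 del'0 e0 e'0 ax bx; set t := Num.min del del' / 2.
have m0 : 0 < Num.min del del' by rewrite lt_min del0.
have t0 : 0 < t by rewrite divr_gt0.
have tm : t < Num.min del del' by rewrite ltr_pdivrMr// mulr_natr mulr2n ltrDl.
pose y := x + t *: e_ R i.
have yx : y - x = t *: e_ R i by rewrite /y addrAC subrr add0r.
have nyx : `|y - x| <= t.
  by rewrite yx normrZ (gtr0_norm t0) -[leRHS]mulr1 ler_wpM2l ?norm_e_le// ltW.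
have ylt : `|y - x| < Num.min del del' by exact: le_lt_trans tm.
move: (ylt); rewrite lt_min => /andP[ydel ydel'].
have A := ax y x ydel; have B := bx y x ydel'.
rewrite subrr normr0 !addr0 !yx !dotvZ !dotv_e -yx in A B.
have {}A := le_trans (A del0) (ler_wpM2l e0 nyx).
have {}B := le_trans (B del'0) (ler_wpM2l e'0 nyx).
rewrite -(ler_pM2l t0) -[t in leLHS](gtr0_norm t0) -normrM.
rewrite (_ : t * _ = (h y - h x - t * b i 0) - (h y - h x - t * a i 0)); last by ring.
apply: le_trans (ler_normB _ _) _; apply: le_trans (lerD B A) _.
by rewrite (_ : e' * t + _ = t * (e + e')) ?lexx//; ring.
Qed.

Lemma affine_approx_perturb h a b x e del (c : R) :
  affine_approx h a e del x -> (forall i, `|a i 0 - b i 0| <= c) ->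
  affine_approx h b (e + d%:R * c) del x.
Proof.
move=> ax abc y y' yx y'x.
have ab u : `|dotv (a - b) u| <= d%:R * c * `|u|.
  by apply: norm_dotv_le => i; rewrite !mxE.
rewrite (_ : h y - h y' - _ = (h y - h y' - dotv a (y - y')) +
    (dotv (a - b) (y - x) - dotv (a - b) (y' - x))); last first.
  by rewrite -dotvBr opprB addrA subrK dotvBl; ring.
apply: le_trans (ler_normD _ _) _; rewrite mulrDl; apply: lerD; first exact: ax.
by apply: le_trans (ler_normB _ _) _; rewrite mulrDr; apply: lerD.
Qed.

Lemma diff_gradE h x u : differentiable h x -> 'd h x u = dotv (grad h x) u.
Proof.
move=> dh; rewrite [u in LHS](_ : u = \sum_i u i 0 *: e_ R i).
  rewrite linear_sum; apply: eq_bigr => i _.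
  by rewrite linearZ/= mxE (deriveE _ dh) mulrC.
apply/colP => i; rewrite summxE (bigD1 i)//= !mxE !eqxx mulr1 big1 ?addr0// => j ji.
by rewrite !mxE eq_sym (negbTE ji) mulr0.
Qed.

Lemma differentiable_affine_approx h x e : differentiable h x -> 0 < e ->
  exists2 del, 0 < del & affine_approx h (grad h x) e del x.
Proof.
move=> dh e0.
have /eqaddoP/(_ _ e0)/nbhs_norm0P[del /= del0 H] := diff_locally dh.
exists del => // y y' yx y'x.
have {}H z : `|z - x| < del -> `|h z - h x - dotv (grad h x) (z - x)| <= e * `|z - x|.
  move=> /H; rewrite -[X in X <= _ -> _]/(`|h (z - x + x) - (h x + 'd h x (z - x))|).
  by rewrite subrK diff_gradE// opprD addrA.
rewrite mulrDr; apply: le_trans (lerD (H _ yx) (H _ y'x)).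
apply: le_trans (ler_normB _ _); rewrite le_eqVlt; apply/orP; left; apply/eqP; congr `|_|.
rewrite (_ : y - y' = (y - x) - (y' - x)); last by rewrite opprB addrA subrK.
by rewrite dotvBr; ring.
Qed.

Lemma differentiable_of_affine_approx h a x :
  (forall e, 0 < e -> exists2 del, 0 < del & affine_approx h a e del x) ->
  differentiable h x.
Proof.
move=> ax.
pose D : {linear 'cV[R]_d -> R} := HB.pack (dotv a)
  (GRing.isLinear.Build _ _ _ _ _ (dotv_is_linear a)).
have Dc : continuous D.
  have dD (z : 'cV[R]_d) : differentiable (dotv a) z.
    rewrite (_ : dotv a = \sum_i (fun z : 'cV[R]_d => a i 0 *: (z i 0 : R^o))).
      by apply: differentiable_sum => i; apply: differentiableZ; exact: differentiable_coord.
    by apply/funext => w; rewrite fct_sumE.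
  move=> z; exact: (differentiable_continuous (dD z)).
have Dx : h \o shift x = cst (h x) + D +o_ (0 : 'cV[R]_d) id.
  apply/eqaddoP => e e0; have [del del0 H] := ax e e0.
  apply/(@nbhs_ballP _ 'cV[R]_d); exists del => // u.
  rewrite -ball_normE /= sub0r normrN => udel.
  (* Taking the second point to be [x] recovers the usual first-order expansion. *)
  have := H (u + x) x; rewrite addrK subrr normr0 addr0 => /(_ udel del0).
  by rewrite opprD addrA.
have dD := diff_unique Dc Dx.
by apply/diff_locallyP; rewrite dD.
Qed.

(** Any two slopes of precisions [1/(m+1)] and [1/(n+1)] differ by at most the sum of these, so the
    intervals of these radii around them meet coordinatewise; the supremum of the left endpoints
    lies in all of them. *)
Lemma exists_common_slope h x :
  (forall n : nat, exists a del, 0 < del /\ affine_approx h a n.+1%:R^-1 del x) ->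
  exists a, forall n b del, 0 < del -> affine_approx h b n.+1%:R^-1 del x ->
    forall i, `|b i 0 - a i 0| <= n.+1%:R^-1.
Proof.
move=> H.
pose E i : set R := [set r | exists n b del, [/\ 0 < del,
  affine_approx h b n.+1%:R^-1 del x & r = b i 0 - n.+1%:R^-1]].
have inv0 n : 0 <= n.+1%:R^-1 :> R by rewrite invr_ge0.
have Eub i n b del : 0 < del -> affine_approx h b n.+1%:R^-1 del x ->
    ubound (E i) (b i 0 + n.+1%:R^-1).
  move=> del0 bx _ [m [c [del' [del'0 cx ->]]]].
  have := affine_approx_close i del'0 del0 (inv0 m) (inv0 n) cx bx.
  by rewrite ler_norml => /andP[_]; move: m.+1%:R^-1 n.+1%:R^-1 => p r ?; lra.
exists (\col_i sup (E i)) => n b del del0 bx i; rewrite mxE.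
have Eb : E i (b i 0 - n.+1%:R^-1) by exists n, b, del.
rewrite ler_norml; apply/andP; split.
  have : sup (E i) <= b i 0 + n.+1%:R^-1.
    by apply: ge_sup; [exists (b i 0 - n.+1%:R^-1)|exact: Eub bx].
  by move: n.+1%:R^-1 => p ?; lra.
have : b i 0 - n.+1%:R^-1 <= sup (E i).
  apply: (@sup_upper_bound _ (E i)) => //; split; first by exists (b i 0 - n.+1%:R^-1).
  by exists (b i 0 + n.+1%:R^-1); exact: Eub bx.
by move: n.+1%:R^-1 => p ?; lra.
Qed.

(** The slopes may be taken rational: this describes the set of
    differentiability points of an arbitrary [h] by countably many closed sets. *)
Lemma differentiableP_rat h x : differentiable h x <->
  forall n : nat, exists (q : 'cV[rat]_d) (m : nat),
    affine_approx h (map_mx ratr q) n.+1%:R^-1 m.+1%:R^-1 x.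
Proof.
split=> [dh n|H].
  have e0 : 0 < n.+1%:R^-1 / 2 :> R by rewrite divr_gt0// invr_gt0.
  have [del del0 gx] := differentiable_affine_approx dh e0.
  (* Half of the tolerance goes to the approximation by the gradient, half to rounding the slope,
     which costs [d * c]; dividing by [d.+1] also covers [d = 0]. *)
  pose c : R := n.+1%:R^-1 / 2 / d.+1%:R.
  have c0 : 0 < c by rewrite divr_gt0.
  have ex i : {q : rat | `|grad h x i 0 - ratr q| <= c}.
    apply/cid; have [q] := @rat_in_itvoo R (grad h x i 0 - c) (grad h x i 0 + c) ltac:(lra).
    by rewrite in_itv/= => /andP[? ?]; exists q; rewrite ler_norml; apply/andP; split; lra.
  have [m mdel] : exists m : nat, m.+1%:R^-1 < del.
    have [m _ /(_ m (leqnn m))] := near_infty_natSinv_lt (PosNum del0).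
    by exists m.
  exists (\col_i sval (ex i)), m.
  have := affine_approx_perturb gx (b := map_mx ratr (\col_i sval (ex i))) (c := c).
  move=> /(_ _)/wrap[i|bx y y' yx y'x].
    by rewrite [map_mx _ _ _ _]mxE [X in ratr X]mxE; exact: (svalP (ex i)).
  have {}bx := bx y y' (lt_trans yx mdel) (lt_trans y'x mdel).
  apply: le_trans bx _; apply: ler_wpM2r; first exact: addr_ge0.
  rewrite -lerBrDl [leRHS](_ : _ = n.+1%:R^-1 / 2); last by field; rewrite ?pnatr_eq0.
  rewrite /c mulrCA ler_piMr ?(ltW e0)// ler_pdivrMr// mul1r ler_nat//.
have [n|a aH] := exists_common_slope (h := h) (x := x).
  have [q [m qm]] := H n; by exists (map_mx ratr q), m.+1%:R^-1; split.
apply: (@differentiable_of_affine_approx _ a) => e e0.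
(* Moving the slope to [a] turns the error [p = 1/(n+1)] into [p + d p], which must stay below
   [e]. *)
have c0 : 0 < e / d.+1%:R by rewrite divr_gt0.
have [n _ /(_ n (leqnn n)) /= ne] := near_infty_natSinv_lt (PosNum c0).
have [q [m qm]] := H n.
have m0 : 0 < m.+1%:R^-1 :> R by rewrite invr_gt0.
exists m.+1%:R^-1 => // y y' yx y'x.
apply: le_trans (affine_approx_perturb qm (aH _ _ _ m0 qm) yx y'x) _.
apply: ler_wpM2r; first exact: addr_ge0.
move: ne; move: n.+1%:R^-1 => p; rewrite ltr_pdivlMr// -natr1 => ?; lra.
Qed.

End affine_approximation.

(** * Measurability of the differentiability set and of the gradient *)

Section differentiability_set.
Variables (R : realType) (d : nat).
Implicit Types (h : 'cV[R]_d -> R) (A B : set 'cV[R]_d).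

Definition vset A : Prop := forall d' (T : measurableType d') (X : T -> 'cV[R]_d),
  (forall i, measurable_fun setT (fun t => X t i 0 : measurableTypeR R)) ->
  measurable (X @^-1` A).

Lemma vsetC A : vset A -> vset (~` A).
Proof. by move=> mA d' T X mX; rewrite preimage_setC; exact/measurableC/mA. Qed.

Lemma vset_bigcup (I : countType) (F : I -> set 'cV[R]_d) :
  (forall i, vset (F i)) -> vset (\bigcup_i F i).
Proof.
move=> mF d' T X mX; rewrite preimage_bigcup.
by apply: countable_bigcupT_measurable => [|i]; [exact: countableP|exact: mF].
Qed.

Lemma vset_bigcap (F : nat -> set 'cV[R]_d) :
  (forall i, vset (F i)) -> vset (\bigcap_i F i).
Proof.
move=> mF d' T X mX; rewrite preimage_bigcap.
by apply: bigcapT_measurable => i; exact: mF.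
Qed.

Lemma vsetI A B : vset A -> vset B -> vset (A `&` B).
Proof.
by move=> mA mB d' T X mX; rewrite preimage_setI; apply: measurableI; [exact: mA|exact: mB].
Qed.

Lemma vset_box (c : 'cV[R]_d) (r : R) : vset [set x : 'cV[R]_d | forall i, `|c i 0 - x i 0| < r].
Proof.
move=> d' T X mX.
rewrite (_ : X @^-1` _ = \bigcap_(i : 'I_d) [set t | `|c i 0 - X t i 0| < r]); last first.
  by apply/seteqP; split => t /= H; [move=> i _; exact: H|move=> i; exact: (H i)].
apply: fin_bigcap_measurable => [|i _]; first exact: finite_finset.
rewrite -[X in measurable X]setTI.
apply: (measurable_fun_ltr (f := fun t => `|c i 0 - X t i 0|) (g := fun=> r)) => //.
apply: measurableT_comp => //; apply: measurable_funB => //; exact: mX.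
Qed.

(** For the max norm, balls are boxes; an open set is the countable union of the boxes with rational
    centre and radius [1/(n+1)] that it contains. *)
Lemma vset_open A : open A -> vset A.
Proof.
move=> oA.
pose F (p : 'cV[rat]_d * nat) : set 'cV[R]_d :=
  [set x : 'cV[R]_d | (forall y : 'cV[R]_d,
       (forall i, `|map_mx ratr p.1 i 0 - y i 0| < p.2.+1%:R^-1) -> A y) /\
     forall i, `|map_mx ratr p.1 i 0 - x i 0| < p.2.+1%:R^-1].
have -> : A = \bigcup_p F p.
  apply/seteqP; split => [x Ax|x [p _ [H1 H2]]]; last exact: H1.
  have [e /= e0 eA] : exists2 e : R, 0 < e & forall y : 'cV[R]_d, `|x - y| < e -> A y.
    have /(@nbhs_ballP _ 'cV[R]_d)[e /= e0] : nbhs x A by exact: open_nbhs_nbhs.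
    by rewrite -ball_normE => H; exists e => // y; exact: H.
  have [n _ /(_ n (leqnn n)) /= ne] := near_infty_natSinv_lt (PosNum (divr_gt0 e0 (ltr0n R 2))).
  have n0 : 0 < n.+1%:R^-1 :> R by [].
  have ex i : {q : rat | `|ratr q - x i 0| < n.+1%:R^-1}.
    apply/cid; move: n0; move: n.+1%:R^-1 => p p0.
    have [q] := @rat_in_itvoo R (x i 0 - p) (x i 0 + p) ltac:(lra).
    by rewrite in_itv/= => /andP[? ?]; exists q; rewrite ltr_norml; apply/andP; split; lra.
  have E i : map_mx ratr (\col_i sval (ex i)) i 0 = ratr (sval (ex i)) :> R.
    by rewrite !mxE.
  exists (\col_i sval (ex i), n) => //; split=> [y yq|i] /=; last first.
    by rewrite E; exact: (svalP (ex i)).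
  apply: eA; rewrite [ltLHS]/Num.norm/= mx_normrE.
  apply/bigmax_ltP; split=> // -[i j] _ /=; rewrite (ord1 j) !mxE.
  have := yq i; have := svalP (ex i); rewrite /= E !ltr_norml.
  move: ne; move: n.+1%:R^-1 (sval (ex i)) => p q pe /andP[? ?] /andP[? ?].
  by apply/andP; split; lra.
apply: vset_bigcup => -[q n] d' T X mX.
(* Containment of the box in [A] does not depend on the point, so the preimage is that of the whole
   box or empty. *)
have [H|H] := pselect (forall y : 'cV[R]_d,
    (forall i, `|map_mx ratr q i 0 - y i 0| < n.+1%:R^-1) -> A y).
  rewrite (_ : _ @^-1` _ = X @^-1` [set x : 'cV[R]_d |
      forall i, `|map_mx ratr q i 0 - x i 0| < n.+1%:R^-1]).
    exact: vset_box.
  by apply/seteqP; split => t /=; [case|].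
rewrite (_ : _ @^-1` _ = set0); first exact: measurable0.
by apply/seteqP; split => t //= [].
Qed.

Lemma vset_closed A : closed A -> vset A.
Proof.
by move=> cA; rewrite -[A]setCK; apply/vsetC/vset_open; rewrite openC.
Qed.

Let approx h n (p : 'cV[rat]_d * nat) :=
  affine_approx h (map_mx ratr p.1) n.+1%:R^-1 p.2.+1%:R^-1.

Let vset_approx h n p : vset (approx h n p).
Proof. by apply/vset_closed/closed_affine_approx; rewrite invr_ge0. Qed.

Lemma vset_differentiable h : vset [set z | differentiable h z].
Proof.
rewrite (_ : [set z | _] = \bigcap_n \bigcup_p approx h n p).
  by apply: vset_bigcap => n; apply: vset_bigcup => p.
apply/seteqP; split => [z /= /differentiableP_rat H n _|z H].
  by have [q [m qm]] := H n; exists (q, m).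
by apply/differentiableP_rat => n; have [[q m] _ qm] := H n I; exists q, m.
Qed.

(** The cutoff matters: where [h] is not differentiable, ['D_v h] may be a junk
    value, and [grad h] need not be measurable. *)
Definition grad0 h (i : 'I_d) (z : 'cV[R]_d) : R :=
  if `[< differentiable h z >] then grad h z i 0 else 0.

(** At a differentiability point a slope of precision [1/(n+1)] is within [1/(n+1)] of the gradient,
    so the gradient exceeds [c] exactly when some rational slope exceeds [c] by more than its
    precision. *)
Lemma vset_grad_gt h i (c : R) :
  vset ([set z | differentiable h z] `&` [set z | c < grad h z i 0]).
Proof.
rewrite (_ : _ `&` _ = [set z | differentiable h z] `&`
  \bigcup_(r : nat * ('cV[rat]_d * nat))
    [set z | c < ratr (r.2.1 i 0) - r.1.+1%:R^-1 /\ approx h r.1 r.2 z]); last first.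
  apply/seteqP; split => z [/= dz].
    move=> cg; split=> //.
    (* Half the excess over [c]: the precision is lost once between gradient and slope, and once
       more in the condition. *)
    have gap : 0 < (grad h z i 0 - c) / 2 by rewrite divr_gt0// subr_gt0.
    have [n _ /(_ n (leqnn n)) /= ng] := near_infty_natSinv_lt (PosNum gap).
    have [q [m qm]] := (differentiableP_rat h z).1 dz n.
    exists (n, (q, m)) => //=; split=> //.
    have H e : 0 < e -> `|grad h z i 0 - ratr (q i 0)| <= e + n.+1%:R^-1.
      move=> e0; have [del del0 gz] := differentiable_affine_approx dz e0.
      have m0 : 0 < m.+1%:R^-1 :> R by [].
      have n0 : 0 <= n.+1%:R^-1 :> R by rewrite invr_ge0.
      by have := affine_approx_close i del0 m0 (ltW e0) n0 gz qm;
      rewrite [map_mx _ _ _ _]mxE.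
    have /ler_addgt0Pr : forall e, 0 < e -> `|grad h z i 0 - ratr (q i 0)| <= n.+1%:R^-1 + e.
      by move=> e /H; rewrite [e + _]addrC.
    rewrite ler_norml => /andP[_]; move: ng; move: n.+1%:R^-1 => p *; lra.
  move=> [[n [q m]] _ /= [cq qm]]; split=> //.
  have /ler_addgt0Pr : forall e, 0 < e -> `|grad h z i 0 - ratr (q i 0)| <= n.+1%:R^-1 + e.
    move=> e e0; have [del del0 gz] := differentiable_affine_approx dz e0.
    have m0 : 0 < m.+1%:R^-1 :> R by [].
    have n0 : 0 <= n.+1%:R^-1 :> R by rewrite invr_ge0.
    by have := affine_approx_close i del0 m0 (ltW e0) n0 gz qm;
      rewrite [map_mx _ _ _ _]mxE [e + _]addrC.
  rewrite ler_norml => /andP[+ _]; move: cq; move: n.+1%:R^-1 => p *; lra.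
apply: vsetI; first exact: vset_differentiable.
apply: vset_bigcup => -[n [q m]] /=.
have [H|H] := pselect (c < ratr (q i 0) - n.+1%:R^-1).
  rewrite (_ : [set z | _] = approx h n (q, m)); first exact: vset_approx.
  by apply/seteqP; split => z /=; [case|].
rewrite (_ : [set z | _] = set0); last by apply/seteqP; split => z //= [].
by move=> d' T X mX; rewrite preimage_set0; exact: measurable0.
Qed.

Lemma vmeasurable_grad0 h i : vmeasurable (grad0 h i : _ -> measurableTypeR R).
Proof.
move=> d' T X mX.
apply: (measurability _ (RGenOInfty.measurableE R)) => _ [_ [c ->] <-]; rewrite setTI.
(* The default value [0] puts the whole nondifferentiability set into the preimage exactly when
   [c < 0]. *)
rewrite (_ : _ @^-1` _ =
    X @^-1` ([set z | differentiable h z] `&` [set z | c < grad h z i 0]) `|`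
    (X @^-1` (~` [set z | differentiable h z]) `&` [set t | c < 0])); last first.
  apply/seteqP; split => t /=; rewrite in_itv/= andbT /grad0; case: asboolP => dt.
  - by left.
  - by right.
  - by case=> [[]|[]].
  - by case=> [[]|[]].
apply: measurableU; first exact: vset_grad_gt.
apply: measurableI; first exact: (vsetC (@vset_differentiable h)).
have [c0|c0] := pselect (c < 0).
  rewrite (_ : [set t | _] = setT); first exact: measurableT.
  by apply/seteqP; split.
rewrite (_ : [set t | _] = set0); first exact: measurable0.
by apply/seteqP; split.
Qed.

End differentiability_set.

(** * Rotation of the gradient information matrix *)

Section gaussian_expectation.
Variables (R : realType) (d : nat).
Implicit Types (f g h : 'cV[R]_d -> R).
Local Open Scope ereal_scope.

Definition gint f : Prop := vmeasurable (f : _ -> measurableTypeR R) /\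
  gexp (fun z => `|(f z)%:E|) < +oo.

Definition gE f : R := fine (gexp (fun z => (f z)%:E)).

Lemma vmeasurable_EFin f : vmeasurable (f : _ -> measurableTypeR R) ->
  vmeasurable (fun z => (f z)%:E).
Proof. by move=> mf d' T X mX; apply/measurable_EFinP; exact: mf. Qed.

Lemma gintE f : gint f -> gexp (fun z => (f z)%:E) = (gE f)%:E.
Proof.
move=> [mf foo]; rewrite /gE fineK// fin_num_abs.
exact: le_lt_trans (abse_gexp_le (vmeasurable_EFin mf)) foo.
Qed.

Lemma le_gint f g : vmeasurable (f : _ -> measurableTypeR R) -> gint g ->
  (forall z, `|f z| <= `|g z|)%R -> gint f.
Proof.
move=> mf [mg goo] fg; split=> //; apply: le_lt_trans goo; apply: le_gexp.
- exact/vmeasurable_abse/vmeasurable_EFin.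
- exact/vmeasurable_abse/vmeasurable_EFin.
- by move=> z; exact: abse_ge0.
- by move=> z; rewrite /= lee_fin.
Qed.

Lemma gintZ (a : R) f : gint f -> gint (fun z => a * f z)%R.
Proof.
move=> [mf foo]; split.
  by move=> d' T X mX; apply: measurable_funM; [exact: measurable_cst|exact: mf].
rewrite (_ : (fun _ => _) = (fun z => `|a|%:E * `|(f z)%:E|)); last first.
  by apply/funext => z /=; rewrite normrM EFinM.
have mf' := vmeasurable_abse (vmeasurable_EFin mf).
rewrite gexpZ//.
- by apply: lte_mul_pinfty => //; rewrite ?lee_fin//.
- by move: foo; congr (gexp _ < _); apply/funext => z; rewrite abse_id.
Qed.

Lemma gEZ (a : R) f : gint f -> gE (fun z => a * f z)%R = (a * gE f)%R.
Proof.
move=> gf; have [mf foo] := gf; apply: EFin_inj.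
rewrite -gintE; last exact: gintZ.
by rewrite EFinM -gintE// -(gexpZ _ (vmeasurable_EFin mf) foo).
Qed.

Lemma gintD f g : gint f -> gint g -> gint (fun z => f z + g z)%R.
Proof.
move=> [mf foo] [mg goo]; split.
  by move=> d' T X mX; apply: measurable_funD; [exact: mf|exact: mg].
have mf' := vmeasurable_abse (vmeasurable_EFin mf).
have mg' := vmeasurable_abse (vmeasurable_EFin mg).
apply: (@le_lt_trans _ _ (gexp (fun z => `|(f z)%:E| + `|(g z)%:E|))).
  apply: le_gexp.
  - apply/vmeasurable_abse/vmeasurable_EFin => d' T X mX.
    by apply: measurable_funD; [exact: mf|exact: mg].
  - by move=> d' T X mX; apply: emeasurable_funD; [exact: mf'|exact: mg'].
  - by move=> z; exact: abse_ge0.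
  - by move=> z; rewrite /= -EFinD lee_fin; exact: ler_normD.
rewrite gexpD//; first exact: lte_add_pinfty.
- by move: foo; congr (gexp _ < _); apply/funext => z; rewrite abse_id.
- by move: goo; congr (gexp _ < _); apply/funext => z; rewrite abse_id.
Qed.

Lemma gED f g : gint f -> gint g -> gE (fun z => f z + g z)%R = (gE f + gE g)%R.
Proof.
move=> gf gg; have [mf foo] := gf; have [mg goo] := gg; apply: EFin_inj.
rewrite -gintE; last exact: gintD.
by rewrite EFinD -!gintE// -(gexpD (vmeasurable_EFin mf) (vmeasurable_EFin mg) foo goo).
Qed.

Lemma gint0 : gint (fun _ => 0%R).
Proof.
have mc (c : R) : vmeasurable ((fun _ => c) : 'cV[R]_d -> measurableTypeR R).
  by move=> d' T X mX; exact: measurable_cst.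
have g1 : gint (fun _ => 1%R).
  split; first exact: mc.
  by rewrite (_ : (fun _ => _) = (fun _ => 1)) ?gexp1 ?ltry//;
    apply/funext => z; rewrite /= normr1.
by apply: le_gint g1 _ => // z; rewrite normr0.
Qed.

Lemma gint_sum (J : Type) (s : seq J) (a : J -> R) (f : J -> 'cV[R]_d -> R) :
  (forall j, gint (f j)) ->
  gint (fun z => \sum_(j <- s) a j * f j z)%R /\
  gE (fun z => \sum_(j <- s) a j * f j z)%R = (\sum_(j <- s) a j * gE (f j))%R.
Proof.
move=> gf; elim: s => [|j s [IHi IHE]].
  have z0 := gint0; rewrite big_nil; under eq_fun do rewrite big_nil; split=> //.
  rewrite -[RHS](mul0r (gE (fun _ => 0%R))) -gEZ//.
  by congr gE; apply/funext => z; rewrite mul0r.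
under eq_fun do rewrite big_cons; rewrite big_cons; split.
  by apply: gintD => //; exact: gintZ.
by rewrite gED// ?IHE ?gEZ//; exact: gintZ.
Qed.

Lemma gint_orthogonal (V : 'M[R]_d) f : orthogonal_mx V -> gint f ->
  gE (fun z => f (V *m z))%R = gE f.
Proof.
move=> oV [mf foo]; rewrite /gE.
by have -> := gexp_orthogonal oV (vmeasurable_EFin mf) foo.
Qed.

(** The exceptional null set is recorded as the support of a function [G], so
    that it can be integrated and composed directly. *)
Definition ae_diff h : Prop := exists G : 'cV[R]_d -> \bar R,
  [/\ vmeasurable G, (forall z, 0 <= G z), gexp G = 0 &
      forall z, G z = 0 -> differentiable h z].

(** The witness is the indicator of the nondifferentiability set, measurable for any [h]
    whatsoever. *)
Lemma ae_differentiable_diff h : ae_differentiable h -> ae_diff h.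
Proof.
rewrite /ae_differentiable gauss_expE => h0.
exists (fun z => (if `[< differentiable h z >] then 0 else 1)%R%:E).
split => // [|z|z].
- move=> d' T X mX; apply/measurable_EFinP; apply: measurable_fun_ifT => //.
  apply: (measurable_fun_bool true); rewrite setTI.
  have := @vset_differentiable _ _ h _ _ X mX; congr measurable.
  by apply/seteqP; split => t /= /asboolP.
- by rewrite lee_fin; case: ifP.
- by case: asboolP => // _ /eqP; rewrite eqe oner_eq0.
Qed.

Lemma ae_diff_comp h (h' : 'cV[R]_d -> R) (phi : 'cV[R]_d -> 'cV[R]_d) :
  scales_lebesgue phi ->
  (forall z, differentiable h (phi z) -> differentiable h' z) ->
  ae_diff h -> ae_diff h'.
Proof.
move=> sphi hh' [G [mG G0 GE Gd]]; exists (G \o phi); split.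
- exact: vmeasurable_comp sphi.1 mG.
- by move=> z; exact: G0.
- exact: gexp_null.
- by move=> z Gz; apply: hh'; exact: Gd.
Qed.

(** This replaces expressions in [grad h], possibly not measurable, by their counterparts in
    [grad0 h]. *)
Lemma ae_diff_grad0 h (F F' : 'cV[R]_d -> \bar R) : ae_diff h ->
  vmeasurable F' -> (forall z, differentiable h z -> F z = F' z) ->
  gexp F = gexp F'.
Proof.
move=> [G [mG G0 GE Gd]] mF' FF'; apply: (gexp_ae mG mF' G0) => // z Gz.
by apply: FF'; exact: Gd.
Qed.

Lemma grad0E h i z : differentiable h z -> grad0 h i z = grad h z i 0%R.
Proof. by rewrite /grad0; case: asboolP. Qed.

(** Finiteness is given for the squares only; mixed products are dominated through
    [|x y| <= x^2 + y^2]. *)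
Lemma gint_grad0M h i j : ae_diff h -> finite_grad_info h ->
  gint (fun z => grad0 h i z * grad0 h j z)%R.
Proof.
move=> dh fh.
have mM k l : vmeasurable (fun z => grad0 h k z * grad0 h l z : measurableTypeR R)%R.
  by move=> d' T X mX; apply: measurable_funM; exact: vmeasurable_grad0.
have g2 k : gint (fun z => grad0 h k z * grad0 h k z)%R.
  split; first exact: mM.
  have := fh k; rewrite /gauss_integrable gauss_expE.
  rewrite (ae_diff_grad0 (F' := fun z => `|(grad0 h k z * grad0 h k z)%:E|) dh)//.
  - exact/vmeasurable_abse/vmeasurable_EFin/mM.
  - by move=> z dz; rewrite /= grad0E// expr2.
apply: (@le_gint _ (fun z => grad0 h i z * grad0 h i z + grad0 h j z * grad0 h j z)%R) => //.
  exact: gintD.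
move=> z; move: (grad0 h i z) (grad0 h j z) => x y.
rewrite [leRHS]ger0_norm; last by rewrite addr_ge0// -expr2 sqr_ge0.
rewrite ler_norml; apply/andP; split; nra.
Qed.

Lemma grad_infoE h i j : ae_diff h ->
  grad_info h i j = gE (fun z => grad0 h i z * grad0 h j z)%R.
Proof.
move=> dh; rewrite mxE gauss_expE; congr fine; apply: (ae_diff_grad0 dh).
  apply: vmeasurable_EFin => d' T X mX.
  by apply: measurable_funM; exact: vmeasurable_grad0.
by move=> z dz; rewrite !grad0E.
Qed.

(** Off a null set, the product of two partial derivatives of [rotfun h V] at [z] is a combination
    [F] of products of partial derivatives of [h], taken at [V z]. Rotation invariance removes [V]
    from the argument, and linearity does the rest. *)
Lemma grad_info_orthogonal h (V : 'M[R]_d) : orthogonal_mx V -> ae_diff h ->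
  finite_grad_info h ->
  (forall z, differentiable h (V *m z)%R ->
    differentiable (rotfun h V) z /\
    grad (rotfun h V) z = (V^T *m grad h (V *m z))%R) ->
  grad_info (rotfun h V) = (V^T *m grad_info h *m V)%R.
Proof.
move=> oV dh fh dV; apply/matrixP => i j.
have sV := mx_scales_unit (orthogonal_unit oV).
have [G [mG G0 GE Gd]] := dh.
pose F w := (\sum_(p : 'I_d * 'I_d) (V p.1 i * V p.2 j) *
  (grad0 h p.1 w * grad0 h p.2 w))%R.
have [Fi FE] := gint_sum (index_enum _) (fun p : 'I_d * 'I_d => V p.1 i * V p.2 j)%R
  (fun p => gint_grad0M p.1 p.2 dh fh).
transitivity (gE (fun z => F (V *m z)%R)).
  rewrite mxE gauss_expE; congr fine.
  (* The exceptional set is the preimage under [V] of that of [h], again null. *)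
  apply: (gexp_ae (g := G \o mulmx V)).
  - exact: vmeasurable_comp sV.1 mG.
  - exact: vmeasurable_EFin (vmeasurable_comp sV.1 Fi.1).
  - by move=> z; exact: G0.
  - move=> z /Gd dz; have [_ gz] := dV z dz; rewrite gz; congr EFin.
    rewrite !mxE big_distrlr/= /F pair_bigA/=; apply: eq_bigr => p _.
    by rewrite !mxE !grad0E// !mxE mulrACA.
  - exact: gexp_null.
rewrite gint_orthogonal//.
rewrite [LHS]FE mxE; under [RHS]eq_bigr do rewrite mxE big_distrl/=.
rewrite exchange_big/= pair_bigA/=; apply: eq_bigr => -[k l] _ /=.
by rewrite grad_infoE// !mxE; ring.
Qed.

End gaussian_expectation.

(** * Chain rule *)

Section affine_chain_rule.
Variables (R : realType) (d : nat).
Implicit Types (h F : 'cV[R]_d -> R) (A U V : 'M[R]_d) (b x z u : 'cV[R]_d).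

Lemma differentiable_mulmx A z : differentiable (mulmx A : 'cV[R]_d -> 'cV[R]_d) z.
Proof.
have -> : (mulmx A : 'cV[R]_d -> 'cV[R]_d) =
    \sum_i (fun z : 'cV[R]_d => (z i 0 : R) *: col i A).
  apply/funext => w; rewrite fct_sumE; apply/colP => k.
  by rewrite mxE summxE; apply: eq_bigr => j _; rewrite !mxE mulrC.
apply: differentiable_sum => i; apply: differentiableZl; exact: differentiable_coord.
Qed.

Lemma diff_mulmx A z u : 'd (mulmx A : 'cV[R]_d -> 'cV[R]_d) z u = A *m u.
Proof.
have Ac : continuous (mulmx A : 'cV[R]_d -> 'cV[R]_d).
  by move=> w; exact: (differentiable_continuous (differentiable_mulmx A w)).
by rewrite (diff_lin z Ac).
Qed.

Lemma differentiable_affine A b z :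
  differentiable (fun w : 'cV[R]_d => A *m w + b) z.
Proof.
by apply: (differentiableD (f := mulmx A) (g := cst b)) => //; exact: differentiable_mulmx.
Qed.

Lemma differentiable_comp_affine h A b z : differentiable h (A *m z + b) ->
  differentiable (fun w => h (A *m w + b)) z.
Proof. by move=> dh; exact: (differentiable_comp (differentiable_affine A b z)). Qed.

Lemma differentiable_rotfun h U z : differentiable h (U *m z) ->
  differentiable (rotfun h U) z.
Proof. by move=> dh; exact: (differentiable_comp (differentiable_mulmx U z)). Qed.

Lemma dotv_tr U x u : dotv x (U *m u) = dotv (U^T *m x) u.
Proof.
transitivity ((x^T *m (U *m u)) 0 0).
  by rewrite mxE; apply: eq_bigr => i _; rewrite [x^T _ _]mxE.
rewrite mulmxA -[x^T *m U]trmxK trmx_mul trmxK mxE.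
by apply: eq_bigr => i _; rewrite [(_^T)%R _ _]mxE.
Qed.

Lemma grad_rotfun h U z : differentiable h (U *m z) ->
  grad (rotfun h U) z = U^T *m grad h (U *m z).
Proof.
move=> dh; apply/colP => i; rewrite mxE (deriveE _ (differentiable_rotfun dh)).
rewrite (diff_comp (differentiable_mulmx U z) dh) /= diff_mulmx diff_gradE//.
by rewrite dotv_tr dotv_e.
Qed.

Lemma derive_grad h u z : differentiable h z -> 'D_u h z = dotv (grad h z) u.
Proof. by move=> dh; rewrite (deriveE _ dh) diff_gradE. Qed.

Lemma hessian_rotfun F U z : twice_differentiable_at F (U *m z) ->
  hessian (rotfun F U) z = U^T *m hessian F (U *m z) *m U.
Proof.
move=> [nF dF]; apply/matrixP => i j.
(* By the chain rule, the [i]-th partial derivative of [rotfun F U] is [rotfun s U] wherever [F] is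
   differentiable. *)
pose s v := \sum_k U k i * grad F v k 0.
have dFk k : differentiable (fun v => grad F v k 0) (U *m z).
  exact: (differentiable_comp dF (differentiable_coord _ _ _)).
have sE : s = \sum_k U k i *: (fun v : 'cV[R]_d => grad F v k 0 : R^o).
  by apply/funext => v; rewrite fct_sumE.
have ds : differentiable s (U *m z).
  by rewrite sE; apply: differentiable_sum => k; apply: differentiableZ; exact: dFk.
have nz : \forall w \near z, differentiable F (U *m w).
  have cU := differentiable_continuous (differentiable_mulmx U z).
  exact: (cU _ nF).
(* That identity holds only near [z], which suffices to differentiate it once more at [z]. *)
rewrite mxE (@near_eq_derive _ _ _ _ (rotfun s U)); last first.
  move: nz; apply: filterS => w dw.
  have /(congr1 (fun M : 'cV[R]_d => M i 0)) := grad_rotfun dw.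
  by rewrite mxE => ->; rewrite mxE; apply: eq_bigr => k _; rewrite [(U^T)%R _ _]mxE.
rewrite (derive_grad _ (differentiable_rotfun ds)) dotv_e (grad_rotfun ds).
rewrite !mxE [RHS](eq_bigr (fun l => U l j * grad s (U *m z) l 0)) => [|l _].
  by apply: eq_bigr => l _; rewrite [(U^T)%R _ _]mxE.
rewrite mulrC; congr (_ * _); rewrite !mxE.
have -> : 'D_(e_ R l) s (U *m z) = \sum_k U k i * 'D_(e_ R l) (fun v => grad F v k 0) (U *m z).
  rewrite sE derive_sum; last by move=> k; exact/derivableZ/diff_derivable/dFk.
  by apply: eq_bigr => k _; rewrite deriveZ//; exact/diff_derivable/dFk.
have gE k : (fun v => grad F v k 0) = (fun v => 'D_(e_ R k) F v).
  by apply/funext => v; rewrite mxE.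
by apply: eq_bigr => k _; rewrite gE !mxE.
Qed.

Lemma differentiable_dot z :
  differentiable (fun w : 'cV[R]_d => (w^T *m w) 0 0 : R) z.
Proof.
rewrite (_ : (fun w => _) = \sum_i
    ((fun w : 'cV[R]_d => w i 0 : R) * (fun w : 'cV[R]_d => w i 0 : R))).
  by apply: differentiable_sum => i; apply: differentiableM; exact: differentiable_coord.
by apply/funext => w; rewrite fct_sumE mxE; apply: eq_bigr => i _; rewrite mxE.
Qed.

Lemma differentiable_gI h mu Gam L z : differentiable h (L *m z + mu) ->
  differentiable (gI h mu Gam L) z.
Proof.
move=> dh; pose E w : R := (w^T *m w) 0 0 / 2 - ((L *m w + mu)^T *m (L *m w + mu)) 0 0 / 2.
have dE : differentiable E z.
  rewrite (_ : E = 2^-1 *: (fun w : 'cV[R]_d => (w^T *m w) 0 0 : R^o)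
     - 2^-1 *: (fun w : 'cV[R]_d => ((L *m w + mu)^T *m (L *m w + mu)) 0 0 : R^o)); last first.
    by apply/funext => w; rewrite /E mulrC [X in _ - X]mulrC.
  apply: differentiableB; apply: differentiableZ; first exact: differentiable_dot.
  exact: (differentiable_comp (differentiable_affine L mu z) (differentiable_dot _)).
rewrite (_ : gI h mu Gam L = (Num.sqrt (\det Gam) *: (fun w => h (L *m w + mu) : R^o)) *
    (expR \o E)); last first.
  by apply/funext => w; rewrite /gI /E /= mulrC [RHS]mulrC; congr (_ * _); exact: mulrC.
apply: differentiableM; first exact/differentiableZ/differentiable_comp_affine.
by apply: differentiable_comp => //; exact/derivable1_diffP/derivable_expR.
Qed.

End affine_chain_rule.

(** * Laplace importance sampling *)

Section laplace_rotation.
Variables (R : realType) (d : nat).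
Implicit Types (g : 'cV[R]_d -> R) (U V L C Q Gam : 'M[R]_d) (mu z : 'cV[R]_d).

Lemma orthogonal_mxC U : orthogonal_mx U -> U *m U^T = 1%:M.
Proof. exact: mulmx1C. Qed.

Lemma orthogonalM U V : orthogonal_mx U -> orthogonal_mx V -> orthogonal_mx (U *m V).
Proof.
by move=> oU oV; rewrite /orthogonal_mx trmx_mul mulmxA -(mulmxA V^T) oU mulmx1.
Qed.

Lemma orthogonal_tr U : orthogonal_mx U -> orthogonal_mx U^T.
Proof. by move=> oU; rewrite /orthogonal_mx trmxK; exact: orthogonal_mxC. Qed.

Lemma dot_orthogonal U z : orthogonal_mx U -> (U *m z)^T *m (U *m z) = z^T *m z.
Proof. by move=> oU; rewrite trmx_mul mulmxA -(mulmxA z^T) oU mulmx1. Qed.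

Lemma drift_solution_rotfun g U mu : orthogonal_mx U -> drift_solution g mu ->
  drift_solution (rotfun g U) (U^T *m mu).
Proof.
move=> oU [g0 dg gmu].
have UK : U *m (U^T *m mu) = mu by rewrite mulmxA (orthogonal_mxC oU) mul1mx.
split.
- by rewrite /rotfun UK.
- by apply: differentiable_rotfun; rewrite UK.
- by rewrite grad_rotfun UK // /rotfun UK scalemxAr gmu.
Qed.

Lemma invmx_orthogonal_conj U C : orthogonal_mx U -> 1%:M - C \in unitmx ->
  invmx (1%:M - U^T *m C *m U) = U^T *m invmx (1%:M - C) *m U.
Proof.
move=> oU uC; have UU := orthogonal_mxC oU.
have -> : 1%:M - U^T *m C *m U = U^T *m (1%:M - C) *m U.
  by rewrite mulmxBr mulmx1 mulmxBl oU.
set B := U^T *m (1%:M - C) *m U; set D := U^T *m invmx _ *m U.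
have DB : D *m B = 1%:M.
  rewrite /D /B !mulmxA -(mulmxA _ U U^T) UU mulmx1 -(mulmxA U^T).
  by rewrite mulVmx// mulmx1.
have [_ uB] := mulmx1_unit DB.
by rewrite -[LHS]mul1mx -DB -mulmxA mulmxV// mulmx1.
Qed.

Lemma eigvec_mx_conj V C Q : orthogonal_mx V -> eigvec_mx C Q ->
  eigvec_mx (V *m C *m V^T) (V *m Q).
Proof.
move=> oV [oQ [lam [lam_dec CE]]]; split; first exact: orthogonalM.
by exists lam; split=> //; rewrite CE trmx_mul !mulmxA.
Qed.

End laplace_rotation.

Theorem theorem3p6 (R : realType) (d : nat) (g1 : 'cV[R]_d -> R) (U : 'M[R]_d)
  (mu1 : 'cV[R]_d) (Gam1 L1 : 'M[R]_d) (mu2 : 'cV[R]_d) (Gam2 L2 : 'M[R]_d) :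
  (forall z, 0 <= g1 z) ->
  ae_differentiable g1 ->
  orthogonal_mx U ->
  laplace_IS_params g1 mu1 Gam1 L1 ->
  laplace_IS_params (rotfun g1 U) mu2 Gam2 L2 ->
  finite_grad_info (gI g1 mu1 Gam1 L1) ->
  finite_grad_info (gI (rotfun g1 U) mu2 Gam2 L2) ->
  exists V : 'M[R]_d,
    [/\ orthogonal_mx V,
        (forall z, gI (rotfun g1 U) mu2 Gam2 L2 z = gI g1 mu1 Gam1 L1 (V *m z)),
        (forall Q1, eigvec_mx (grad_info (gI g1 mu1 Gam1 L1)) Q1 ->
           eigvec_mx (grad_info (gI (rotfun g1 U) mu2 Gam2 L2)) (V^T *m Q1) /\
           (forall z, gI g1 mu1 Gam1 L1 (Q1 *m z)
                      = gI (rotfun g1 U) mu2 Gam2 L2 ((V^T *m Q1) *m z))) &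
        (forall Q2, eigvec_mx (grad_info (gI (rotfun g1 U) mu2 Gam2 L2)) Q2 ->
           eigvec_mx (grad_info (gI g1 mu1 Gam1 L1)) (V *m Q2))].
Proof.
move=> g10 dg1 oU [s1 [_ [td1 [u1 [Gam1E [_ L1E]]]]]] [_ [uniq2 [_ [_ [Gam2E [_ L2E]]]]]] f1 _.
have UU := orthogonal_mxC oU.
(* [U^T *m mu1] solves the rotated drift equation, hence equals [mu2]. *)
have mu2E : U *m mu2 = mu1.
  by rewrite -(uniq2 _ (drift_solution_rotfun oU s1)) mulmxA UU mul1mx.
have HE : hessian (fun w => ln (rotfun g1 U w)) mu2 =
    U^T *m hessian (fun w => ln (g1 w)) mu1 *m U.
  have := @hessian_rotfun R d (fun w => ln (g1 w)) U mu2.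
  by rewrite mu2E => /(_ td1).
have Gam12 : Gam2 = U^T *m Gam1 *m U.
  by rewrite Gam1E Gam2E HE invmx_orthogonal_conj.
have uL1 : L1 \in unitmx.
  have : Gam1 \in unitmx by rewrite Gam1E unitmx_inv.
  by rewrite -L1E unitmx_mul => /andP[].
pose V := invmx L1 *m U *m L2.
(* Here [V V^T = L1^-1 (U Gam2 U^T) L1^-T = L1^-1 Gam1 L1^-T = 1]. *)
have oV : orthogonal_mx V.
  apply: mulmx1C; rewrite /V !trmx_mul !mulmxA -(mulmxA _ L2) L2E Gam12 !mulmxA.
  rewrite -(mulmxA _ U U^T) UU mulmx1 -(mulmxA _ U U^T) UU mulmx1 -L1E.
  by rewrite mulmxA mulVmx// mul1mx trmx_inv mulmxV// unitmx_tr.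
have L1V z : U *m (L2 *m z + mu2) = L1 *m (V *m z) + mu1.
  by rewrite mulmxDr mu2E /V !mulmxA mulmxV// mul1mx.
have detE : \det Gam2 = \det Gam1.
  by rewrite Gam12 !det_mulmx mulrC mulrA -det_mulmx UU det1 mul1r.
have gIE : gI (rotfun g1 U) mu2 Gam2 L2 = rotfun (gI g1 mu1 Gam1 L1) V.
  apply/funext => z; rewrite /rotfun /gI detE -L1V.
  by rewrite (dot_orthogonal z oV) (dot_orthogonal (L2 *m z + mu2) oU).
(* The affine map inside [gI] preserves null sets because [L1] is invertible. *)
have dI : ae_diff (gI g1 mu1 Gam1 L1).
  apply: (ae_diff_comp (scales_lebesgue_affine mu1 uL1)) (ae_differentiable_diff dg1).
  by move=> z; exact: differentiable_gI.
have CE : grad_info (gI (rotfun g1 U) mu2 Gam2 L2) =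
    V^T *m grad_info (gI g1 mu1 Gam1 L1) *m V.
  rewrite gIE; apply: grad_info_orthogonal => // z dz; split.
    exact: differentiable_rotfun.
  exact: grad_rotfun.
have VV := orthogonal_mxC oV.
exists V; split; first exact: oV.
- by move=> z; rewrite gIE.
- move=> Q1 Q1e; split; last by move=> z; rewrite gIE /rotfun !mulmxA VV mul1mx.
  by have := eigvec_mx_conj (orthogonal_tr oV) Q1e; rewrite trmxK CE.
- clearbody V; move=> Q2 Q2e; have := eigvec_mx_conj oV Q2e.
  by rewrite CE !mulmxA VV mul1mx -(mulmxA _ V V^T) VV mulmx1.
Qed.
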